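(* Let $(\mathbb{C},\boxtimes,I)$ be a symmetric normal oplax monoidal closed double category such that: (I) $\mathbb{C}$ is fibrant; (II) each category $\mathrm{Mnd}_A(\mathbb{C})$ has finite coproducts; (III) $\mathbb{C}_0$ has equalisers; (IV) $\mathbb{C}$ has 1-tabulators. Then the symmetric multicategory $\mathsf{MultMnd}(\mathbb{C})$ of monads and monad multimorphisms in $\mathbb{C}$ is closed. More precisely, for any monads $(B,b),(C,c)$ there exist a monad $[\![(B,b),(C,c)]\!]$ and a binary monad multimorphism $$(e,\varepsilon_1,\varepsilon_2)\colon[\![(B,b),(C,c)]\!],(B,b)\to(C,c)$$ composition with which induces bijections between monad multimorphisms $(f,\phi_1,\dots,\phi_n,\psi)\colon(A_1,a_1),\dots,(A_n,a_n),(B,b)\to(C,c)$ and monad multimorphisms $(\bar f,\bar\phi_1,\dots,\bar\phi_n)\colon(A_1,a_1),\dots,(A_n,a_n)\to[\![(B,b),(C,c)]\!]$, for all monads $(A_1,a_1),\dots,(A_n,a_n)$.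
   Context: Double categories. A (pseudo) double category $\mathbb{C}$ has a category $\mathbb{C}_0$ (objects and vertical maps), a category $\mathbb{C}_1$ (horizontal maps and 2-morphisms), source and target functors $\mathfrak{s},\mathfrak{t}\colon\mathbb{C}_1\to\mathbb{C}_0$, and functors $\circ\colon\mathbb{C}_1\times_{\mathbb{C}_0}\mathbb{C}_1\to\mathbb{C}_1$ and $\mathrm{id}\colon\mathbb{C}_0\to\mathbb{C}_1$, associative and unital up to coherent natural globular isomorphism (coherence cells are suppressed). Write $x\colon A\nrightarrow B$ for a horizontal map with $\mathfrak{s}(x)=A$, $\mathfrak{t}(x)=B$, and $y\circ x\colon A\nrightarrow C$ for its composite with $y\colon B\nrightarrow C$. A 2-morphism $\alpha\colon x\to y$ lies over the pair of vertical maps $(\mathfrak{s}(\alpha),\mathfrak{t}(\alpha))$, and over $f$ if both equal $f$; it is globular if both are identities. $\mathbb{C}[A,B]$ is the category of horizontal maps $A\nrightarrow B$ and globular 2-morphisms. $\mathbb{C}$ is fibrant if $(\mathfrak{s},\mathfrak{t})\colon\mathbb{C}_1\to\mathbb{C}_0\times\mathbb{C}_0$ is a Grothendieck fibration. $\mathbb{C}$ has 1-tabulators if $\mathrm{id}\colon\mathbb{C}_0\to\mathbb{C}_1$ has a right adjoint. Monads. $\mathrm{End}(\mathbb{C})$ has objects pairs $(A,x\colon A\nrightarrow A)$ and maps $(f,\phi)\colon(A,x)\to(B,y)$ with $f\colon A\to B$ vertical and $\phi\colon x\to y$ a 2-morphism over $f$. A monad $(A,a)$ is an object of $\mathrm{End}(\mathbb{C})$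 with globular $\mu\colon a\circ a\to a$, $\eta\colon\mathrm{id}_A\to a$ satisfying associativity and unit laws; a monad map is a map $(f,\phi)$ of $\mathrm{End}(\mathbb{C})$ with $\phi\mu=\mu(\phi\circ\phi)$ and $\phi\eta=\eta\,\mathrm{id}_f$. These form $\mathrm{Mnd}(\mathbb{C})$; $\mathrm{Mnd}_A(\mathbb{C})$ is the fibre over $A$ of the forgetful functor to $\mathbb{C}_0$. The discrete monad on $A$ is $\Delta_A=(A,\mathrm{id}_A)$. Oplax monoidal structure. An oplax monoidal structure $(\boxtimes,I)$ on $\mathbb{C}$ consists of oplax double functors $\boxtimes\colon\mathbb{C}\times\mathbb{C}\to\mathbb{C}$ and $I\colon\mathbf{1}\to\mathbb{C}$ with invertible vertical transformations for associativity and units satisfying the usual coherence axioms. Explicitly: monoidal structures $(\boxtimes,I_0)$ on $\mathbb{C}_0$ and $(\boxtimes,I_1)$ on $\mathbb{C}_1$ with $\mathfrak{s},\mathfrak{t}$ strict monoidal, and globular 2-morphisms $\xi\colon(y_1\circ x_1)\boxtimes(y_2\circ x_2)\to(y_1\boxtimes y_2)\circ(x_1\boxtimes x_2)$, $\upsilon\colon\mathrm{id}_{A_1}\boxtimes\mathrm{id}_{A_2}\to\mathrm{id}_{A_1\boxtimes A_2}$, $\delta\colon I_1\to I_1\circ I_1$, $\iota\colon I_1\to\mathrm{id}_{I_0}$ making $\boxtimes$ and $I$ oplax double functors and the associativity and unit constraints vertical transformations. It is normal if $\upsilon,\delta,\iota$ are invertible and $\xi$ is invertible whenever $x_1=y_1=\mathrm{id}_{A_1}$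 or $x_2=y_2=\mathrm{id}_{A_2}$. It is symmetric if $\mathbb{C}_0$ and $\mathbb{C}_1$ are symmetric monoidal, $\mathfrak{s},\mathfrak{t}$ preserve the symmetries strictly, and the symmetries are compatible with $\xi$ and $\upsilon$ (i.e. form a vertical transformation). It is closed if there are right adjoints $(-)\boxtimes B\dashv\langle B,-\rangle_0$ on $\mathbb{C}_0$ and $(-)\boxtimes y\dashv\langle y,-\rangle_1$ on $\mathbb{C}_1$ such that $\mathfrak{s},\mathfrak{t}$ strictly preserve the internal homs and the evaluation maps. Monad multimorphisms. By normality, tensoring a monad on either side with discrete monads gives a monad (structure built using $\xi^{-1},\upsilon^{-1}$). A monad multimorphism $(f,\phi_1,\dots,\phi_n)\colon(A_1,a_1),\dots,(A_n,a_n)\to(B,b)$ is a vertical map $f\colon A_1\boxtimes\cdots\boxtimes A_n\to B$ with 2-morphisms $\phi_i\colon\mathrm{id}_{A_1}\boxtimes\cdots\boxtimes a_i\boxtimes\cdots\boxtimes\mathrm{id}_{A_n}\to b$ over $f$ such that each $(f,\phi_i)\colon\Delta_{A_1}\boxtimes\cdots\boxtimes(A_i,a_i)\boxtimes\cdots\boxtimes\Delta_{A_n}\to(B,b)$ is a monad map (for $n=0$: a vertical map $I\to B$). Monads and monad multimorphisms form a symmetric multicategory $\mathsf{MultMnd}(\mathbb{C})$: for $(g,\vec\theta)\colon(B_1,b_1),\dots,(B_m,b_m)\to(C,c)$ and $(f,\vec\phi)\colon(A_1,a_1),\dots,(A_n,a_n)\to(B_i,b_i)$, the composite $(g,\vec\theta)\circ_i(f,\vec\phi)$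 has vertical map $g(1\boxtimes f\boxtimes1)$ and 2-morphisms $\theta_k(1\boxtimes\mathrm{id}_f\boxtimes1)$ (with the evident placement and normality isomorphisms) for inputs $b_k$, $k\neq i$, and $\theta_i(1\boxtimes\phi_j\boxtimes1)$ for inputs $a_j$; identities are identity monad maps; permutations act via the symmetry of $\boxtimes$. *)

(* Defs.v *)
From Stdlib Require Import ProofIrrelevance.
From mathcomp Require Import all_boot.

Set Implicit Arguments.
Unset Strict Implicit.
Unset Printing Implicit Defensive.

Record cat_on (ob : Type) := CatOn {
  hom_on : ob -> ob -> Type;
  idm_on : forall x, hom_on x x;
  comp_on : forall x y z, hom_on y z -> hom_on x y -> hom_on x z;
  comp1m_on : forall x y (f : hom_on x y), comp_on (idm_on y) f = f;
  compm1_on : forall x y (f : hom_on x y), comp_on f (idm_on x) = f;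
  compA_on : forall w x y z (h : hom_on y z) (g : hom_on x y) (f : hom_on w x),
    comp_on h (comp_on g f) = comp_on (comp_on h g) f
}.

Record category := Cat { ob :> Type; ob_cat : cat_on ob }.

Definition hom (C : category) : C -> C -> Type := hom_on (ob_cat C).
Definition idm (C : category) (x : C) : hom x x := idm_on (ob_cat C) x.
Definition cmp (C : category) (x y z : C) (g : hom y z) (f : hom x y) :
  hom x z := comp_on g f.
Arguments hom {C} x y.
Arguments idm {C} x.

Notation "g ∘ f" := (cmp g f) (at level 40, left associativity).

Lemma cmp1m (C : category) (x y : C) (f : hom x y) : idm y ∘ f = f.
Proof. exact: comp1m_on. Qed.

Lemma cmpm1 (C : category) (x y : C) (f : hom x y) : f ∘ idm x = f.
Proof. exact: compm1_on. Qed.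

Lemma cmpA (C : category) (w x y z : C) (h : hom y z) (g : hom x y)
  (f : hom w x) : h ∘ (g ∘ f) = h ∘ g ∘ f.
Proof. exact: compA_on. Qed.

Record is_iso (C : category) (x y : C) (f : hom x y) := IsIso {
  inv : hom y x;
  inv_comp : inv ∘ f = idm x;
  comp_inv : f ∘ inv = idm y
}.
Arguments inv {C x y f} i.

Record iso (C : category) (x y : C) := Iso {
  fwd :> hom x y;
  fwd_iso : is_iso fwd
}.
Arguments iso {C} x y.
Definition bwd (C : category) (x y : C) (i : iso x y) : hom y x :=
  inv (fwd_iso i).

(** The object map of a functor is kept apart from its action on maps, so that
    it can be prescribed up to conversion. *)
Record functorial (C D : category) (F : C -> D) := Functorial {
  fmap : forall x y : C, hom x y -> hom (F x) (F y);
  fmap1 : forall x, fmap (idm x) = idm (F x);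
  fmapD : forall x y z (g : hom y z) (f : hom x y),
    fmap (g ∘ f) = fmap g ∘ fmap f
}.
Arguments fmap {C D F} FF {x y} f : rename.

Record adjunction (C D : category) (L : C -> D) (R : D -> C)
    (LF : functorial L) (RF : functorial R) := Adjunction {
  adj_unit : forall x, hom x (R (L x));
  adj_counit : forall y, hom (L (R y)) y;
  adj_unit_nat : forall x x' (f : hom x x'),
    adj_unit x' ∘ f = fmap RF (fmap LF f) ∘ adj_unit x;
  adj_counit_nat : forall y y' (g : hom y y'),
    adj_counit y' ∘ fmap LF (fmap RF g) = g ∘ adj_counit y;
  adj_triangle_l : forall x, adj_counit (L x) ∘ fmap LF (adj_unit x) = idm (L x);
  adj_triangle_r : forall y, fmap RF (adj_counit y) ∘ adj_unit (R y) = idm (R y)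
}.

Definition has_right_adjoint (C D : category) (L : C -> D)
    (LF : functorial L) : Prop :=
  exists (R : D -> C) (RF : functorial R), inhabited (adjunction LF RF).

Definition has_equalisers (C : category) : Prop :=
  forall (x y : C) (f g : hom x y), exists (e : C) (i : hom e x),
    f ∘ i = g ∘ i /\
    forall (z : C) (h : hom z x), f ∘ h = g ∘ h -> exists! k : hom z e, i ∘ k = h.

Definition has_finite_coproducts (C : category) : Prop :=
  forall (n : nat) (x : 'I_n -> C), exists (s : C) (inj : forall i, hom (x i) s),
    forall (y : C) (f : forall i, hom (x i) y),
      exists! u : hom s y, forall i, u ∘ inj i = f i.

Record monoidal_on (C : category) (T : C -> C -> C) (U : C) := MonoidalOn {
  tmor : forall x x' y y', hom x x' -> hom y y' -> hom (T x y) (T x' y');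
  tmor1 : forall x y, tmor (idm x) (idm y) = idm (T x y);
  tmorD : forall x x' x'' y y' y'' (f' : hom x' x'') (f : hom x x')
      (g' : hom y' y'') (g : hom y y'),
    tmor (f' ∘ f) (g' ∘ g) = tmor f' g' ∘ tmor f g;
  tassoc : forall x y z, iso (T (T x y) z) (T x (T y z));
  tlunit : forall x, iso (T U x) x;
  trunit : forall x, iso (T x U) x;
  tassoc_nat : forall x x' y y' z z' (f : hom x x') (g : hom y y') (h : hom z z'),
    tassoc x' y' z' ∘ tmor (tmor f g) h = tmor f (tmor g h) ∘ tassoc x y z;
  tlunit_nat : forall x x' (f : hom x x'),
    tlunit x' ∘ tmor (idm U) f = f ∘ tlunit x;
  trunit_nat : forall x x' (f : hom x x'),
    trunit x' ∘ tmor f (idm U) = f ∘ trunit x;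
  tpentagon : forall w x y z,
    tassoc w x (T y z) ∘ tassoc (T w x) y z =
    tmor (idm w) (tassoc x y z) ∘ tassoc w (T x y) z ∘ tmor (tassoc w x y) (idm z);
  ttriangle : forall x y,
    tmor (idm x) (tlunit y) ∘ tassoc x U y = tmor (trunit x) (idm y)
}.
Arguments tmor {C T U} m {x x' y y'} f g : rename.

Record symmetry_on (C : category) (T : C -> C -> C) (U : C)
    (M : monoidal_on T U) := SymmetryOn {
  braid : forall x y, hom (T x y) (T y x);
  braid_nat : forall x x' y y' (f : hom x x') (g : hom y y'),
    braid x' y' ∘ tmor M f g = tmor M g f ∘ braid x y;
  braid_sym : forall x y, braid y x ∘ braid x y = idm (T x y);
  braid_hexagon : forall x y z,
    tassoc M y z x ∘ braid x (T y z) ∘ tassoc M x y z =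
    tmor M (idm y) (braid x z) ∘ tassoc M y x z ∘ tmor M (braid x y) (idm z)
}.

Definition tensr (C : category) (T : C -> C -> C) (U : C) (M : monoidal_on T U)
  (y : C) : functorial (fun x => T x y).
Proof.
exists (fun _ _ f => tmor M f (idm y)) => [x|x x' x'' g f]; first exact: tmor1.
by rewrite -tmorD cmp1m.
Defined.

(** Horizontal maps form a family [hor A B]; [hobj hor] is the resulting type
    of all horizontal maps, i.e. the objects of C_1. Strictness of a source or
    target on objects is thus conversion. *)
#[projections(primitive)]
Record hobj (ob : Type) (hor : ob -> ob -> Type) := Hob {
  hsrc : ob;
  htgt : ob;
  hmap : hor hsrc htgt
}.
Arguments Hob {ob hor hsrc htgt} hmap.

(** The functor hcomp is defined on the pullback C_1 x_{C_0} C_1: on 2-morphisms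
    it takes as last argument a proof that the vertical boundaries match. Every
    equation below is quantified over all the matching proofs that it mentions;
    these always exist and are irrelevant. *)
Record dbl_data := DblData {
  C0 : category;
  hor : C0 -> C0 -> Type;
  C1_on : cat_on (hobj hor);
  C1 : category := Cat C1_on;
  srcF : functorial (fun x : C1 => hsrc x);
  tgtF : functorial (fun x : C1 => htgt x);
  hid : forall A, hor A A;
  hidF : functorial (fun A : C0 => Hob (hid A) : C1);
  hcomp : forall A B C, hor B C -> hor A B -> hor A C;
  hc : forall A A' B B' C C' (y : hor B C) (y' : hor B' C')
      (x : hor A B) (x' : hor A' B')
      (beta : @hom C1 (Hob y) (Hob y')) (alpha : @hom C1 (Hob x) (Hob x')),
    fmap tgtF alpha = fmap srcF beta ->
    @hom C1 (Hob (hcomp y x)) (Hob (hcomp y' x'));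
  hassoc : forall A B C D (z : hor C D) (y : hor B C) (x : hor A B),
    @iso C1 (Hob (hcomp (hcomp z y) x)) (Hob (hcomp z (hcomp y x)));
  hlunit : forall A B (x : hor A B), @iso C1 (Hob (hcomp (hid B) x)) (Hob x);
  hrunit : forall A B (x : hor A B), @iso C1 (Hob (hcomp x (hid A))) (Hob x)
}.
Arguments hor {d} _ _.
Arguments hid {d} A.
Arguments hc {d A A' B B' C C' y y' x x'} beta alpha e : rename.
Arguments hassoc {d A B C D} z y x.
Arguments hlunit {d A B} x.
Arguments hrunit {d A B} x.

Notation "y ⊙ x" := (hcomp y x) (at level 39, left associativity).
Notation "x ⇒ y" := (@hom (C1 _) (Hob x) (Hob y)) (at level 70).
Notation sq_src := (fmap (srcF _)).
Notation sq_tgt := (fmap (tgtF _)).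
Notation id1 x := (@idm (C1 _) (Hob x)).

Definition globular (D : dbl_data) (A B : C0 D) (x y : hor A B)
  (alpha : x ⇒ y) : Prop :=
  sq_src alpha = idm A /\ sq_tgt alpha = idm B.

Record dbl_laws (D : dbl_data) : Prop := DblLaws {
  hid_src : forall (A B : C0 D) (f : hom A B), sq_src (fmap (hidF D) f) = f;
  hid_tgt : forall (A B : C0 D) (f : hom A B), sq_tgt (fmap (hidF D) f) = f;
  hc_src : forall (A A' B B' C C' : C0 D) (y : hor B C) (y' : hor B' C')
      (x : hor A B) (x' : hor A' B') (beta : y ⇒ y') (alpha : x ⇒ x') e,
    sq_src (hc beta alpha e) = sq_src alpha;
  hc_tgt : forall (A A' B B' C C' : C0 D) (y : hor B C) (y' : hor B' C')
      (x : hor A B) (x' : hor A' B') (beta : y ⇒ y') (alpha : x ⇒ x') e,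
    sq_tgt (hc beta alpha e) = sq_tgt beta;
  hc1 : forall (A B C : C0 D) (y : hor B C) (x : hor A B) e,
    hc (id1 y) (id1 x) e = id1 (y ⊙ x);
  hcD : forall (A A' A'' B B' B'' C C' C'' : C0 D)
      (y : hor B C) (y' : hor B' C') (y'' : hor B'' C'')
      (x : hor A B) (x' : hor A' B') (x'' : hor A'' B'')
      (beta' : y' ⇒ y'') (beta : y ⇒ y') (alpha' : x' ⇒ x'') (alpha : x ⇒ x')
      e e1 e2,
    hc (beta' ∘ beta) (alpha' ∘ alpha) e = hc beta' alpha' e1 ∘ hc beta alpha e2;
  hassoc_glob : forall (A B C E : C0 D) (z : hor C E) (y : hor B C) (x : hor A B),
    globular (hassoc z y x);
  hlunit_glob : forall (A B : C0 D) (x : hor A B), globular (hlunit x);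
  hrunit_glob : forall (A B : C0 D) (x : hor A B), globular (hrunit x);
  hassoc_nat : forall (A A' B B' C C' E E' : C0 D)
      (z : hor C E) (z' : hor C' E') (y : hor B C) (y' : hor B' C')
      (x : hor A B) (x' : hor A' B')
      (gamma : z ⇒ z') (beta : y ⇒ y') (alpha : x ⇒ x') e1 e2 e3 e4,
    hassoc z' y' x' ∘ hc (hc gamma beta e1) alpha e2 =
    hc gamma (hc beta alpha e3) e4 ∘ hassoc z y x;
  hlunit_nat : forall (A A' B B' : C0 D) (x : hor A B) (x' : hor A' B')
      (alpha : x ⇒ x') e,
    hlunit x' ∘ hc (fmap (hidF D) (sq_tgt alpha)) alpha e = alpha ∘ hlunit x;
  hrunit_nat : forall (A A' B B' : C0 D) (x : hor A B) (x' : hor A' B')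
      (alpha : x ⇒ x') e,
    hrunit x' ∘ hc alpha (fmap (hidF D) (sq_src alpha)) e = alpha ∘ hrunit x;
  hpentagon : forall (A B C E F : C0 D)
      (z : hor E F) (y : hor C E) (x : hor B C) (w : hor A B) e1 e2,
    hassoc z y (x ⊙ w) ∘ hassoc (z ⊙ y) x w =
    hc (id1 z) (hassoc y x w) e1 ∘ hassoc z (y ⊙ x) w
      ∘ hc (hassoc z y x) (id1 w) e2;
  htriangle : forall (A B C : C0 D) (y : hor B C) (x : hor A B) e1 e2,
    hc (id1 y) (hlunit x) e1 ∘ hassoc y (hid B) x = hc (hrunit y) (id1 x) e2
}.

Record dbl_cat := DblCat { dbl_of :> dbl_data; dbl_ax :> dbl_laws dbl_of }.

Definition cartesian (D : dbl_cat) (A A' B B' : C0 D) (x : hor A B)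
    (x' : hor A' B') (phi : x ⇒ x') : Prop :=
  forall (E F : C0 D) (w : hor E F) (psi : w ⇒ x') (u : hom E A) (v : hom F B),
    sq_src psi = sq_src phi ∘ u -> sq_tgt psi = sq_tgt phi ∘ v ->
    exists! chi : w ⇒ x, [/\ sq_src chi = u, sq_tgt chi = v & phi ∘ chi = psi].

Definition fibrant (D : dbl_cat) : Prop :=
  forall (A A' B B' : C0 D) (x' : hor A' B') (f : hom A A') (g : hom B B'),
    exists (x : hor A B) (phi : x ⇒ x'),
      [/\ sq_src phi = f, sq_tgt phi = g & cartesian phi].

Definition has_1_tabulators (D : dbl_cat) : Prop := has_right_adjoint (hidF D).

Section Monads.
Variable D : dbl_cat.

Record mnd_str (A : C0 D) (a : hor A A) := MndStr {
  mu : a ⊙ a ⇒ a;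
  eta : hid A ⇒ a
}.

Record mnd_laws (A : C0 D) (a : hor A A) (S : mnd_str a) : Prop := MndLaws {
  mu_glob : globular (mu S);
  eta_glob : globular (eta S);
  muA : forall e1 e2,
    mu S ∘ hc (mu S) (id1 a) e1 = mu S ∘ hc (id1 a) (mu S) e2 ∘ hassoc a a a;
  mu_etal : forall e, mu S ∘ hc (eta S) (id1 a) e = hlunit a;
  mu_etar : forall e, mu S ∘ hc (id1 a) (eta S) e = hrunit a
}.

Record monad_at (A : C0 D) := MonadAt {
  mcar : hor A A;
  mstr : mnd_str mcar;
  mlaws : mnd_laws mstr
}.

Record monad := Monad { mob : C0 D; mat :> monad_at mob }.

Record is_mnd_map (A B : C0 D) (a : hor A A) (b : hor B B) (S : mnd_str a)
    (S' : mnd_str b) (f : hom A B) (phi : a ⇒ b) : Prop := IsMndMap {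
  mm_src : sq_src phi = f;
  mm_tgt : sq_tgt phi = f;
  mm_mu : forall e, phi ∘ mu S = mu S' ∘ hc phi phi e;
  mm_eta : phi ∘ eta S = eta S' ∘ fmap (hidF D) f
}.

Lemma is_mnd_map_id (A : C0 D) (a : hor A A) (S : mnd_str a) :
  is_mnd_map S S (idm A) (id1 a).
Proof.
split; rewrite ?fmap1 //; last by rewrite cmp1m cmpm1.
by move=> e; rewrite (hc1 D) cmp1m cmpm1.
Qed.

Lemma is_mnd_map_comp (A B C : C0 D) (a : hor A A) (b : hor B B) (c : hor C C)
  (Sa : mnd_str a) (Sb : mnd_str b) (Sc : mnd_str c) g f
  (psi : b ⇒ c) (phi : a ⇒ b) :
  is_mnd_map Sb Sc g psi -> is_mnd_map Sa Sb f phi ->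
  is_mnd_map Sa Sc (g ∘ f) (psi ∘ phi).
Proof.
case=> s t m u [s' t' m' u']; split; rewrite ?fmapD ?s ?t ?s' ?t' //.
- have e1 : sq_tgt psi = sq_src psi by rewrite s t.
  have e2 : sq_tgt phi = sq_src phi by rewrite s' t'.
  by move=> e; rewrite (hcD D _ e1 e2) cmpA -(m e1) -!cmpA (m' e2).
- by rewrite -cmpA u' cmpA u -cmpA.
Qed.

End Monads.

(** The fibre over A of the forgetful functor Mnd(C) -> C_0. *)
Section MndFibre.
Variables (D : dbl_cat) (A : C0 D).

Definition mnd_hom (m n : monad_at A) :=
  {phi : mcar m ⇒ mcar n | is_mnd_map (mstr m) (mstr n) (idm A) phi}.

Lemma mnd_hom_eq (m n : monad_at A) (p q : mnd_hom m n) :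
  proj1_sig p = proj1_sig q -> p = q.
Proof.
case: p q => p hp [q hq] /= e; subst q; congr exist; exact: proof_irrelevance.
Qed.

Definition mnd_cmp (m n p : monad_at A) (g : mnd_hom n p) (f : mnd_hom m n) :
  mnd_hom m p.
Proof.
exists (proj1_sig g ∘ proj1_sig f).
have := is_mnd_map_comp (proj2_sig g) (proj2_sig f).
by rewrite cmp1m.
Defined.

Definition Mnd : category.
Proof.
refine (@Cat (monad_at A) (@CatOn _ mnd_hom
  (fun m => exist _ _ (is_mnd_map_id (mstr m))) mnd_cmp _ _ _)).
- by move=> m n f; apply: mnd_hom_eq; rewrite /= cmp1m.
- by move=> m n f; apply: mnd_hom_eq; rewrite /= cmpm1.
- by move=> m n p q h g f; apply: mnd_hom_eq; rewrite /= cmpA.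
Defined.

End MndFibre.

Record oplax_data (D : dbl_cat) := OplaxData {
  otens : C0 D -> C0 D -> C0 D;
  ounit : C0 D;
  M0 : monoidal_on otens ounit;
  htens : forall A1 B1 A2 B2 : C0 D,
    hor A1 B1 -> hor A2 B2 -> hor (otens A1 A2) (otens B1 B2);
  hunit : hor ounit ounit;
  M1 : monoidal_on (fun x y : C1 D => Hob (htens (hmap x) (hmap y)) : C1 D)
         (Hob hunit : C1 D);
  xi : forall (A1 B1 E1 A2 B2 E2 : C0 D) (x1 : hor A1 B1) (y1 : hor B1 E1)
         (x2 : hor A2 B2) (y2 : hor B2 E2),
    htens (y1 ⊙ x1) (y2 ⊙ x2) ⇒ htens y1 y2 ⊙ htens x1 x2;
  upsilon : forall A1 A2 : C0 D, htens (hid A1) (hid A2) ⇒ hid (otens A1 A2);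
  delta : hunit ⇒ hunit ⊙ hunit;
  iota : hunit ⇒ hid ounit
}.
Arguments ounit {D} o.
Arguments hunit {D} o.
Arguments xi {D} o {A1 B1 E1 A2 B2 E2} x1 y1 x2 y2.
Arguments upsilon {D} o A1 A2.
Arguments delta {D} o.
Arguments iota {D} o.

Notation "A ⊠[ M ] B" := (otens M A B)
  (at level 38, left associativity, format "A  ⊠[ M ]  B").
Notation "x ⊠h[ M ] y" := (htens M x y)
  (at level 38, left associativity, format "x  ⊠h[ M ]  y").
Notation "f ⊠v[ M ] g" := (tmor (M0 M) f g)
  (at level 38, left associativity, format "f  ⊠v[ M ]  g").
Notation "alpha ⊠s[ M ] beta" := (tmor (M1 M) alpha beta)
  (at level 38, left associativity, format "alpha  ⊠s[ M ]  beta").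

Section OplaxLaws.
Variables (D : dbl_cat) (M : oplax_data D).
Implicit Types (A B E : C0 D).

Local Notation "A ⊠ B" := (A ⊠[M] B) (at level 38, left associativity).
Local Notation "x ⊠h y" := (x ⊠h[M] y) (at level 38, left associativity).
Local Notation "f ⊠v g" := (f ⊠v[M] g) (at level 38, left associativity).
Local Notation "a ⊠s b" := (a ⊠s[M] b) (at level 38, left associativity).
Local Notation "'a_' x y z" := (fwd (tassoc (M1 M) (Hob x) (Hob y) (Hob z)))
  (at level 10, x at level 9, y at level 9, z at level 9).
Local Notation "'l_' x" := (fwd (tlunit (M1 M) (Hob x))) (at level 10, x at level 9).
Local Notation "'r_' x" := (fwd (trunit (M1 M) (Hob x))) (at level 10, x at level 9).

Record strict_boundaries : Prop := StrictBoundaries {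
  tens_src : forall (x x' y y' : C1 D) (alpha : hom x x') (beta : hom y y'),
    sq_src (alpha ⊠s beta) = sq_src alpha ⊠v sq_src beta;
  tens_tgt : forall (x x' y y' : C1 D) (alpha : hom x x') (beta : hom y y'),
    sq_tgt (alpha ⊠s beta) = sq_tgt alpha ⊠v sq_tgt beta;
  tassoc_src : forall x y z : C1 D,
    sq_src (tassoc (M1 M) x y z) = tassoc (M0 M) (hsrc x) (hsrc y) (hsrc z);
  tassoc_tgt : forall x y z : C1 D,
    sq_tgt (tassoc (M1 M) x y z) = tassoc (M0 M) (htgt x) (htgt y) (htgt z);
  tlunit_src : forall x : C1 D, sq_src (tlunit (M1 M) x) = tlunit (M0 M) (hsrc x);
  tlunit_tgt : forall x : C1 D, sq_tgt (tlunit (M1 M) x) = tlunit (M0 M) (htgt x);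
  trunit_src : forall x : C1 D, sq_src (trunit (M1 M) x) = trunit (M0 M) (hsrc x);
  trunit_tgt : forall x : C1 D, sq_tgt (trunit (M1 M) x) = trunit (M0 M) (htgt x)
}.

Record tensor_oplax : Prop := TensorOplax {
  xi_glob : forall A1 B1 E1 A2 B2 E2 (x1 : hor A1 B1) (y1 : hor B1 E1)
      (x2 : hor A2 B2) (y2 : hor B2 E2), globular (xi M x1 y1 x2 y2);
  upsilon_glob : forall A1 A2, globular (upsilon M A1 A2);
  xi_nat : forall A1 A1' B1 B1' E1 E1' A2 A2' B2 B2' E2 E2'
      (x1 : hor A1 B1) (x1' : hor A1' B1') (y1 : hor B1 E1) (y1' : hor B1' E1')
      (x2 : hor A2 B2) (x2' : hor A2' B2') (y2 : hor B2 E2) (y2' : hor B2' E2')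
      (alpha1 : x1 ⇒ x1') (beta1 : y1 ⇒ y1')
      (alpha2 : x2 ⇒ x2') (beta2 : y2 ⇒ y2') e1 e2 e,
    xi M x1' y1' x2' y2' ∘ (hc beta1 alpha1 e1 ⊠s hc beta2 alpha2 e2) =
    hc (beta1 ⊠s beta2) (alpha1 ⊠s alpha2) e ∘ xi M x1 y1 x2 y2;
  upsilon_nat : forall A1 A1' A2 A2' (f1 : hom A1 A1') (f2 : hom A2 A2'),
    upsilon M A1' A2' ∘ (fmap (hidF D) f1 ⊠s fmap (hidF D) f2) =
    fmap (hidF D) (f1 ⊠v f2) ∘ upsilon M A1 A2;
  xi_assoc : forall A1 B1 E1 F1 A2 B2 E2 F2
      (x1 : hor A1 B1) (y1 : hor B1 E1) (z1 : hor E1 F1)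
      (x2 : hor A2 B2) (y2 : hor B2 E2) (z2 : hor E2 F2) e1 e2,
    hassoc (z1 ⊠h z2) (y1 ⊠h y2) (x1 ⊠h x2)
      ∘ hc (xi M y1 z1 y2 z2) (id1 (x1 ⊠h x2)) e1
      ∘ xi M x1 (z1 ⊙ y1) x2 (z2 ⊙ y2) =
    hc (id1 (z1 ⊠h z2)) (xi M x1 y1 x2 y2) e2
      ∘ xi M (y1 ⊙ x1) z1 (y2 ⊙ x2) z2
      ∘ (hassoc z1 y1 x1 ⊠s hassoc z2 y2 x2);
  xi_lunit : forall A1 B1 A2 B2 (x1 : hor A1 B1) (x2 : hor A2 B2) e,
    hlunit (x1 ⊠h x2) ∘ hc (upsilon M B1 B2) (id1 (x1 ⊠h x2)) e
      ∘ xi M x1 (hid B1) x2 (hid B2) =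
    hlunit x1 ⊠s hlunit x2;
  xi_runit : forall A1 B1 A2 B2 (x1 : hor A1 B1) (x2 : hor A2 B2) e,
    hrunit (x1 ⊠h x2) ∘ hc (id1 (x1 ⊠h x2)) (upsilon M A1 A2) e
      ∘ xi M (hid A1) x1 (hid A2) x2 =
    hrunit x1 ⊠s hrunit x2
}.

Record unit_oplax : Prop := UnitOplax {
  delta_glob : globular (delta M);
  iota_glob : globular (iota M);
  delta_coassoc : forall e1 e2,
    hassoc (hunit M) (hunit M) (hunit M)
      ∘ hc (delta M) (id1 (hunit M)) e1 ∘ delta M =
    hc (id1 (hunit M)) (delta M) e2 ∘ delta M;
  delta_counitl : forall e,
    hlunit (hunit M) ∘ hc (iota M) (id1 (hunit M)) e ∘ delta M = id1 (hunit M);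
  delta_counitr : forall e,
    hrunit (hunit M) ∘ hc (id1 (hunit M)) (iota M) e ∘ delta M = id1 (hunit M)
}.

(** The constraints are vertical transformations between composites of oplax
    double functors: compatibility with composition, then with identities. *)
Record constraints_vertical : Prop := ConstraintsVertical {
  tassoc_xi : forall A1 B1 E1 A2 B2 E2 A3 B3 E3
      (x1 : hor A1 B1) (y1 : hor B1 E1) (x2 : hor A2 B2) (y2 : hor B2 E2)
      (x3 : hor A3 B3) (y3 : hor B3 E3) e,
    hc (a_ y1 y2 y3) (a_ x1 x2 x3) e
      ∘ xi M (x1 ⊠h x2) (y1 ⊠h y2) x3 y3
      ∘ (xi M x1 y1 x2 y2 ⊠s id1 (y3 ⊙ x3)) =
    xi M x1 y1 (x2 ⊠h x3) (y2 ⊠h y3)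
      ∘ (id1 (y1 ⊙ x1) ⊠s xi M x2 y2 x3 y3)
      ∘ a_ (y1 ⊙ x1) (y2 ⊙ x2) (y3 ⊙ x3);
  tassoc_upsilon : forall A1 A2 A3,
    fmap (hidF D) (fwd (tassoc (M0 M) A1 A2 A3))
      ∘ upsilon M (A1 ⊠ A2) A3 ∘ (upsilon M A1 A2 ⊠s id1 (hid A3)) =
    upsilon M A1 (A2 ⊠ A3) ∘ (id1 (hid A1) ⊠s upsilon M A2 A3)
      ∘ a_ (hid A1) (hid A2) (hid A3);
  tlunit_xi : forall A B E (x : hor A B) (y : hor B E) e,
    hc (l_ y) (l_ x) e ∘ xi M (hunit M) (hunit M) x y
      ∘ (delta M ⊠s id1 (y ⊙ x)) = l_ (y ⊙ x);
  tlunit_upsilon : forall A,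
    fmap (hidF D) (fwd (tlunit (M0 M) A)) ∘ upsilon M (ounit M) A
      ∘ (iota M ⊠s id1 (hid A)) = l_ (hid A);
  trunit_xi : forall A B E (x : hor A B) (y : hor B E) e,
    hc (r_ y) (r_ x) e ∘ xi M x y (hunit M) (hunit M)
      ∘ (id1 (y ⊙ x) ⊠s delta M) = r_ (y ⊙ x);
  trunit_upsilon : forall A,
    fmap (hidF D) (fwd (trunit (M0 M) A)) ∘ upsilon M A (ounit M)
      ∘ (id1 (hid A) ⊠s iota M) = r_ (hid A)
}.

End OplaxLaws.

Record oplax_monoidal (D : dbl_cat) := OplaxMonoidal {
  oplax_of :> oplax_data D;
  oplax_strict : strict_boundaries oplax_of;
  oplax_tensor : tensor_oplax oplax_of;
  oplax_unit : unit_oplax oplax_of;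
  oplax_constraints : constraints_vertical oplax_of
}.

Record normal (D : dbl_cat) (M : oplax_monoidal D) := Normal {
  upsilon_iso : forall A1 A2 : C0 D, is_iso (upsilon M A1 A2);
  delta_iso : is_iso (delta M);
  iota_iso : is_iso (iota M);
  xi_iso_l : forall (A1 A2 B2 E2 : C0 D) (x2 : hor A2 B2) (y2 : hor B2 E2),
    is_iso (xi M (hid A1) (hid A1) x2 y2);
  xi_iso_r : forall (A1 B1 E1 A2 : C0 D) (x1 : hor A1 B1) (y1 : hor B1 E1),
    is_iso (xi M x1 y1 (hid A2) (hid A2))
}.

Record symmetric_dbl (D : dbl_cat) (M : oplax_monoidal D) := SymmetricDbl {
  sym0 : symmetry_on (M0 M);
  sym1 : symmetry_on (M1 M);
  braid_src : forall x y : C1 D,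
    sq_src (braid sym1 x y) = braid sym0 (hsrc x) (hsrc y);
  braid_tgt : forall x y : C1 D,
    sq_tgt (braid sym1 x y) = braid sym0 (htgt x) (htgt y);
  braid_xi : forall (A1 B1 E1 A2 B2 E2 : C0 D) (x1 : hor A1 B1) (y1 : hor B1 E1)
      (x2 : hor A2 B2) (y2 : hor B2 E2) e,
    hc (braid sym1 (Hob y1) (Hob y2)) (braid sym1 (Hob x1) (Hob x2)) e
      ∘ xi M x1 y1 x2 y2 =
    xi M x2 y2 x1 y1 ∘ braid sym1 (Hob (y1 ⊙ x1)) (Hob (y2 ⊙ x2));
  braid_upsilon : forall A1 A2 : C0 D,
    fmap (hidF D) (braid sym0 A1 A2) ∘ upsilon M A1 A2 =
    upsilon M A2 A1 ∘ braid sym1 (Hob (hid A1)) (Hob (hid A2))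
}.

Record closed_dbl (D : dbl_cat) (M : oplax_monoidal D) := ClosedDbl {
  ihom0 : C0 D -> C0 D -> C0 D;
  ihom0F : forall B : C0 D, functorial (ihom0 B);
  ihom0_adj : forall B : C0 D, adjunction (tensr (M0 M) B) (ihom0F B);
  ihom1 : forall B B' E E' : C0 D,
    hor B B' -> hor E E' -> hor (ihom0 B E) (ihom0 B' E');
  ihom1F : forall y : C1 D,
    functorial (fun z : C1 D => Hob (ihom1 (hmap y) (hmap z)) : C1 D);
  ihom1_adj : forall y : C1 D, adjunction (tensr (M1 M) y) (ihom1F y);
  ev_src : forall y z : C1 D,
    sq_src (adj_counit (ihom1_adj y) z) = adj_counit (ihom0_adj (hsrc y)) (hsrc z);
  ev_tgt : forall y z : C1 D,
    sq_tgt (adj_counit (ihom1_adj y) z) = adj_counit (ihom0_adj (htgt y)) (htgt z)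
}.

Lemma is_iso_cmp (C : category) (x y z : C) (g : hom y z) (f : hom x y) :
  is_iso g -> is_iso f -> is_iso (g ∘ f).
Proof.
move=> [g' gl gr] [f' fl fr]; exists (f' ∘ g').
- by rewrite -cmpA (cmpA g') gl cmp1m.
- by rewrite -cmpA (cmpA f) fr cmp1m.
Defined.

Lemma is_iso_inv (C : category) (x y : C) (f : hom x y) (i : is_iso f) :
  is_iso (inv i).
Proof. by exists f; case: i. Defined.

Lemma is_iso_idm (C : category) (x : C) : is_iso (idm x).
Proof. by exists (idm x); rewrite cmp1m. Defined.

Lemma is_iso_tmor (C : category) T U (M : @monoidal_on C T U) (x x' y y' : C)
  (f : hom x x') (g : hom y y') : is_iso f -> is_iso g -> is_iso (tmor M f g).
Proof.
move=> [f' fl fr] [g' gl gr]; exists (tmor M f' g').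
- by rewrite -tmorD fl gl tmor1.
- by rewrite -tmorD fr gr tmor1.
Defined.

Lemma iso_cancel (C : category) (x y z : C) (f : hom x y) (i : is_iso f)
  (g h : hom y z) : g ∘ f = h ∘ f -> g = h.
Proof.
by move=> e; rewrite -(cmpm1 g) -(cmpm1 h) -(comp_inv i) !cmpA e.
Qed.

Lemma inv_uniq (C : category) (x y : C) (f : hom x y) (g h : hom y x) :
  g ∘ f = idm x -> f ∘ h = idm y -> g = h.
Proof. by move=> e e'; rewrite -(cmpm1 g) -e' cmpA e cmp1m. Qed.

Section HcLemmas.
Variable D : dbl_cat.
Implicit Types (A B C : C0 D).

Lemma hid_glob A : globular (id1 (@hid D A)).
Proof. by split; rewrite fmap1. Qed.

Lemma glob_inv A B (x y : hor A B) (alpha : x ⇒ y) (i : is_iso alpha) :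
  globular alpha -> globular (inv i).
Proof.
move=> [s t]; split.
- by have := fmapD (srcF D) (inv i) alpha; rewrite inv_comp fmap1 s cmpm1.
- by have := fmapD (tgtF D) (inv i) alpha; rewrite inv_comp fmap1 t cmpm1.
Qed.

Lemma inv_match A A' B B' C C' (y : hor B C) (y' : hor B' C')
  (x : hor A B) (x' : hor A' B') (beta : y ⇒ y') (alpha : x ⇒ x')
  (i : is_iso beta) (j : is_iso alpha) :
  sq_tgt alpha = sq_src beta -> sq_tgt (inv j) = sq_src (inv i).
Proof.
move=> e; apply: (@inv_uniq _ _ _ (sq_tgt alpha)).
- by have := fmapD (tgtF D) (inv j) alpha; rewrite inv_comp fmap1.
- by rewrite e; have := fmapD (srcF D) beta (inv i); rewrite comp_inv fmap1.
Qed.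

Lemma match_cmp A A' A'' B B' B'' C C' C'' (y : hor B C) (y' : hor B' C')
  (y'' : hor B'' C'') (x : hor A B) (x' : hor A' B') (x'' : hor A'' B'')
  (beta' : y' ⇒ y'') (beta : y ⇒ y') (alpha' : x' ⇒ x'') (alpha : x ⇒ x') :
  sq_tgt alpha' = sq_src beta' -> sq_tgt alpha = sq_src beta ->
  sq_tgt (alpha' ∘ alpha) = sq_src (beta' ∘ beta).
Proof. by move=> e1 e2; rewrite !fmapD e1 e2. Qed.

Lemma hc_cmp A A' A'' B B' B'' C C' C'' (y : hor B C) (y' : hor B' C')
  (y'' : hor B'' C'') (x : hor A B) (x' : hor A' B') (x'' : hor A'' B'')
  (beta' : y' ⇒ y'') (beta : y ⇒ y') (alpha' : x' ⇒ x'') (alpha : x ⇒ x') e1 e2 :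
  hc beta' alpha' e1 ∘ hc beta alpha e2 =
  hc (beta' ∘ beta) (alpha' ∘ alpha) (match_cmp e1 e2).
Proof. by symmetry; apply: (hcD D). Qed.

Lemma hc_ext A A' B B' C C' (y : hor B C) (y' : hor B' C')
  (x : hor A B) (x' : hor A' B') (beta beta' : y ⇒ y') (alpha alpha' : x ⇒ x') e e' :
  beta = beta' -> alpha = alpha' -> hc beta alpha e = hc beta' alpha' e'.
Proof. by move=> E1 E2; subst; congr hc; exact: proof_irrelevance. Qed.

Lemma match1 A B C (y : hor B C) (x : hor A B) : sq_tgt (id1 x) = sq_src (id1 y).
Proof. by rewrite !fmap1. Qed.

Lemma is_iso_hc A A' B B' C C' (y : hor B C) (y' : hor B' C')
  (x : hor A B) (x' : hor A' B') (beta : y ⇒ y') (alpha : x ⇒ x') e :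
  is_iso beta -> is_iso alpha -> is_iso (hc beta alpha e).
Proof.
move=> i j; exists (hc (inv i) (inv j) (inv_match i j e)).
- by rewrite hc_cmp (hc_ext _ (match1 y x) (inv_comp i) (inv_comp j)) (hc1 D).
- by rewrite hc_cmp (hc_ext _ (match1 y' x') (comp_inv i) (comp_inv j)) (hc1 D).
Defined.

Lemma glob_match A B C (y y' : hor B C) (x x' : hor A B) (beta : y ⇒ y')
  (alpha : x ⇒ x') : globular beta -> globular alpha -> sq_tgt alpha = sq_src beta.
Proof. by move=> [-> _] [_ ->]. Qed.
End HcLemmas.

Section Tensor.
Variables (D : dbl_cat) (M : oplax_monoidal D) (N : normal M).
Implicit Types (A B : C0 D).

Local Notation "A ⊠ B" := (A ⊠[M] B) (at level 38, left associativity).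
Local Notation "x ⊠h y" := (x ⊠h[M] y) (at level 38, left associativity).
Local Notation "f ⊠v g" := (f ⊠v[M] g) (at level 38, left associativity).
Local Notation "a ⊠s b" := (a ⊠s[M] b) (at level 38, left associativity).

Definition discr_str A : mnd_str (hid A) :=
  MndStr (fwd (hlunit (hid A))) (id1 (hid A)).

(** The tensor product of two monads is a monad as soon as the relevant
    component of xi is invertible. *)
Definition tens_str A B (a : hor A A) (b : hor B B) (S : mnd_str a)
    (S' : mnd_str b) (i : is_iso (xi M a a b b)) : mnd_str (a ⊠h b) :=
  MndStr ((mu S ⊠s mu S') ∘ inv i) ((eta S ⊠s eta S') ∘ inv (upsilon_iso N A B)).

Lemma tens_glob A A' B B' (x x' : hor A A') (y y' : hor B B') (alpha : x ⇒ x')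
  (beta : y ⇒ y') : globular alpha -> globular beta ->
  globular (alpha ⊠s beta : x ⊠h y ⇒ x' ⊠h y').
Proof.
have T := oplax_strict M.
move=> [s t] [s' t']; split.
- by apply: etrans (tens_src T alpha beta) _; rewrite s s'; exact: tmor1.
- by apply: etrans (tens_tgt T alpha beta) _; rewrite t t'; exact: tmor1.
Qed.

Lemma xi_iso_conj A A2 B2 E2 (a : hor A A) (i : a ⇒ hid A) (x : hor A2 B2)
  (y : hor B2 E2) : globular i -> is_iso i -> is_iso (xi M a a x y).
Proof.
move=> gi ii.
have gj := glob_inv ii gi; have jj := is_iso_inv ii.
pose j := inv ii; rewrite -/j in gj jj.
have e1 : sq_tgt j = sq_src j by apply: glob_match.
have ex := match1 y x.
have gx : globular (id1 x) by split; rewrite fmap1.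
have gy : globular (id1 y) by split; rewrite fmap1.
have e : sq_tgt (j ⊠s id1 x) = sq_src (j ⊠s id1 y) by apply: glob_match; exact: tens_glob.
have H := xi_nat (oplax_tensor M) e1 ex e.
have K : is_iso (hc j j e1 ⊠s hc (id1 y) (id1 x) ex).
  by apply: is_iso_tmor; apply: is_iso_hc => //; exact: is_iso_idm.
have L : is_iso (xi M a a x y ∘ (hc j j e1 ⊠s hc (id1 y) (id1 x) ex)).
  rewrite H; apply: is_iso_cmp (xi_iso_l N _ _ _).
  by apply: is_iso_hc; apply: is_iso_tmor => //; exact: is_iso_idm.
have -> : xi M a a x y = xi M a a x y ∘ (hc j j e1 ⊠s hc (id1 y) (id1 x) ex) ∘ inv K.
  by rewrite -cmpA comp_inv cmpm1.
by apply: is_iso_cmp L _; exact: is_iso_inv.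
Qed.

(** The nonempty lists A_1, ..., A_n of monads, built by adding the last one.
    Tensor products are bracketed to the left: (A_1 ⊠ A_2) ⊠ ... ⊠ A_n. *)
Inductive ctx := One of monad D | Snoc of ctx & monad D.

Fixpoint tobj (G : ctx) : C0 D :=
  match G with One m => mob m | Snoc G' m => tobj G' ⊠ mob m end.

(** id_{A_1} ⊠ ... ⊠ id_{A_n}, which normality identifies with the identity of
    A_1 ⊠ ... ⊠ A_n through [disc_norm]. *)
Fixpoint disc (G : ctx) : hor (tobj G) (tobj G) :=
  match G with
  | One m => hid (mob m)
  | Snoc G' m => disc G' ⊠h hid (mob m)
  end.

Fixpoint disc_norm (G : ctx) : disc G ⇒ hid (tobj G) :=
  match G with
  | One m => id1 (hid (mob m))
  | Snoc G' m =>
      upsilon M (tobj G') (mob m) ∘ (disc_norm G' ⊠s id1 (hid (mob m)))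
  end.

Lemma disc_norm_glob (G : ctx) : globular (disc_norm G).
Proof.
elim: G => [m|G IH m] /=; first exact: hid_glob.
have [s t] := upsilon_glob (oplax_tensor M) (tobj G) (mob m).
have [s' t'] := tens_glob IH (hid_glob (mob m)).
by split; rewrite fmapD ?s ?t ?s' ?t' cmp1m.
Qed.

Lemma disc_norm_iso (G : ctx) : is_iso (disc_norm G).
Proof.
elim: G => [m|G IH m] /=; first exact: is_iso_idm.
apply: is_iso_cmp; first exact: upsilon_iso.
by apply: is_iso_tmor IH _; exact: is_iso_idm.
Qed.

Definition xi_disc (G : ctx) (m : monad D) :
  is_iso (xi M (disc G) (disc G) (mcar m) (mcar m)) :=
  xi_iso_conj _ _ (disc_norm_glob G) (disc_norm_iso G).

Fixpoint disc_str (G : ctx) : mnd_str (disc G) :=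
  match G return mnd_str (disc G) with
  | One m => discr_str (mob m)
  | Snoc G' m =>
      tens_str (disc_str G') (discr_str (mob m))
        (xi_iso_r N (mob m) (disc G') (disc G'))
  end.

(** The indices 1, ..., n: in [Snoc G m], [None] is the last one. *)
Fixpoint pos (G : ctx) : Type :=
  match G with One _ => unit | Snoc G' _ => option (pos G') end.

(** [slot p] is id_{A_1} ⊠ ... ⊠ a_p ⊠ ... ⊠ id_{A_n}, and [slot_str p] its
    monad structure as the iterated tensor product of a_p with discrete monads. *)
Fixpoint slot (G : ctx) : pos G -> hor (tobj G) (tobj G) :=
  match G with
  | One m => fun _ => mcar m
  | Snoc G' m => fun p =>
      if p is Some q then slot q ⊠h hid (mob m) else disc G' ⊠h mcar m
  end.

Fixpoint slot_str (G : ctx) : forall p : pos G, mnd_str (slot p) :=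
  match G return forall p : pos G, mnd_str (slot p) with
  | One m => fun _ => mstr m
  | Snoc G' m => fun p =>
      match p return mnd_str (@slot (Snoc G' m) p) with
      | Some q => tens_str (slot_str q) (discr_str (mob m))
                    (xi_iso_r N (mob m) (slot q) (slot q))
      | None => tens_str (disc_str G') (mstr m) (xi_disc G' m)
      end
  end.

(** All finite lists of monads; [None] is the empty one, with tensor product I. *)
Definition inputs := option ctx.

Definition append (G : inputs) (m : monad D) : inputs :=
  Some (if G is Some G' then Snoc G' m else One m).

Definition dom_obj (G : inputs) : C0 D := if G is Some G' then tobj G' else ounit M.

Definition input_pos (G : inputs) : Type := if G is Some G' then pos G' else void.

Definition input_slot (G : inputs) : input_pos G -> hor (dom_obj G) (dom_obj G) :=
  match G with Some G' => @slot G' | None => fun p => match p with end end.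

Definition input_str (G : inputs) : forall p : input_pos G, mnd_str (input_slot p) :=
  match G with Some G' => @slot_str G' | None => fun p => match p with end end.

Record multimorphism (G : inputs) (m : monad D) := Multimorphism {
  mm_map : hom (dom_obj G) (mob m);
  mm_cell : forall p : input_pos G, input_slot p ⇒ mcar m;
  mm_monad_map : forall p,
    is_mnd_map (input_str p) (mstr m) mm_map (mm_cell p)
}.

Lemma stensD A A' A'' B B' B'' E E' E'' F F' F''
  (x : hor A B) (x' : hor A' B') (x'' : hor A'' B'')
  (y : hor E F) (y' : hor E' F') (y'' : hor E'' F'')
  (alpha' : x' ⇒ x'') (alpha : x ⇒ x') (beta' : y' ⇒ y'') (beta : y ⇒ y') :
  @cmp (C1 D) (Hob (x ⊠h y)) (Hob (x' ⊠h y')) (Hob (x'' ⊠h y''))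
    (alpha' ⊠s beta') (alpha ⊠s beta) = (alpha' ∘ alpha) ⊠s (beta' ∘ beta).
Proof. by symmetry; exact: tmorD. Qed.

Lemma hlunit_nat' A A' B B' (x : hor A B) (x' : hor A' B') (alpha : x ⇒ x') g e :
  sq_tgt alpha = g ->
  hlunit x' ∘ hc (fmap (hidF D) g) alpha e = alpha ∘ hlunit x.
Proof. by move=> E; subst g; apply: (hlunit_nat D). Qed.

Lemma discr_map A B (f : hom A B) :
  is_mnd_map (discr_str A) (discr_str B) f (fmap (hidF D) f).
Proof.
split; rewrite ?(hid_src D) ?(hid_tgt D) //.
- by move=> e; rewrite /= hlunit_nat' ?(hid_tgt D).
- by rewrite cmp1m cmpm1.
Qed.

Lemma tens_map A A' B B' (a : hor A A) (a' : hor A' A') (b : hor B B)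
  (b' : hor B' B') (S : mnd_str a) (S' : mnd_str a') (T : mnd_str b)
  (T' : mnd_str b') i i' f g (phi : a ⇒ a') (psi : b ⇒ b') :
  is_mnd_map S S' f phi -> is_mnd_map T T' g psi ->
  is_mnd_map (tens_str S T i) (tens_str S' T' i') (f ⊠v g) (phi ⊠s psi).
Proof.
case=> s t m u [s' t' m' u'].
have X := oplax_strict M; have Y := oplax_tensor M.
split.
- by apply: etrans (tens_src X phi psi) _; rewrite s s'.
- by apply: etrans (tens_tgt X phi psi) _; rewrite t t'.
- move=> e /=.
  have e1 : sq_tgt phi = sq_src phi by rewrite s t.
  have e2 : sq_tgt psi = sq_src psi by rewrite s' t'.
  rewrite cmpA stensD (m e1) (m' e2) -stensD -!cmpA.
  congr (_ ∘ _); apply: (iso_cancel i).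
  by rewrite -!cmpA inv_comp cmpm1 -(xi_nat Y e1 e2 e) cmpA inv_comp cmp1m.
- rewrite /= cmpA stensD u u' -stensD -!cmpA.
  congr (_ ∘ _); apply: (iso_cancel (upsilon_iso N A B)).
  by rewrite -!cmpA inv_comp cmpm1 -(upsilon_nat Y) cmpA inv_comp cmp1m.
Qed.

Lemma upsilon_map A B i :
  is_mnd_map (tens_str (discr_str A) (discr_str B) i) (discr_str (A ⊠ B))
    (idm (A ⊠ B)) (upsilon M A B).
Proof.
have Y := oplax_tensor M; have [s t] := upsilon_glob Y A B.
split=> //.
- move=> e /=; apply: (iso_cancel i); rewrite -!cmpA inv_comp cmpm1.
  have g1 : globular (id1 (hid A ⊠h hid B)) by split; rewrite fmap1.
  have e1 : sq_tgt (id1 (hid A ⊠h hid B)) = sq_src (upsilon M A B).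
    by apply: glob_match => //; exact: upsilon_glob.
  have e2 : sq_tgt (upsilon M A B) = sq_src (id1 (hid (A ⊠ B))).
    by rewrite t fmap1.
  rewrite -(xi_lunit Y e1) !cmpA; congr (_ ∘ _).
  have e3 : sq_tgt (upsilon M A B) = sq_src (fmap (hidF D) (idm (A ⊠ B))).
    by rewrite t (hid_src D).
  rewrite -(hlunit_nat' e3 t) -!cmpA; congr (_ ∘ _).
  by rewrite hc_cmp; apply: hc_ext; rewrite ?fmap1 ?cmp1m ?cmpm1.
- rewrite /= fmap1 cmp1m cmpA; apply: (iso_cancel (upsilon_iso N A B)).
  rewrite -!cmpA inv_comp cmp1m cmpm1.
  by have -> : id1 (hid A) ⊠s id1 (hid B) = id1 (hid A ⊠h hid B);
    [exact: tmor1 | rewrite cmpm1].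
Qed.

Lemma disc_norm_map (G : ctx) :
  is_mnd_map (disc_str G) (discr_str (tobj G)) (idm (tobj G)) (disc_norm G).
Proof.
elim: G => [m|G IH m]; first exact: is_mnd_map_id.
rewrite -(cmp1m (idm _)) /=; apply: is_mnd_map_comp.
  exact: (upsilon_map (xi_iso_l N _ _ _)).
rewrite -(tmor1 (M0 M)); apply: tens_map => //; exact: is_mnd_map_id.
Qed.

Lemma lunit_map (m : monad D) :
  is_mnd_map (mstr m)
    (tens_str (discr_str (ounit M)) (mstr m) (xi_iso_l N _ (mcar m) (mcar m)))
    (bwd (tlunit (M0 M) (mob m)))
    ((iota M ⊠s id1 (mcar m)) ∘ bwd (tlunit (M1 M) (Hob (mcar m)))).
Proof.
set a := mcar m; set L := tlunit (M1 M) (Hob a).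
set L0 := tlunit (M0 M) (mob m); set j := _ ∘ _.
have X := oplax_strict M; have Y := oplax_tensor M; have U := oplax_unit M.
have V := oplax_constraints M.
have gi := iota_glob U; have gd := delta_glob U.
have ga : globular (id1 a) by split; rewrite fmap1.
have gia : globular (iota M ⊠s id1 a : hunit M ⊠h a ⇒ hid (ounit M) ⊠h a).
  exact: tens_glob.
have sL : sq_src (fwd L) = fwd L0 by rewrite (tlunit_src X).
have tL : sq_tgt (fwd L) = fwd L0 by rewrite (tlunit_tgt X).
have jL : j ∘ fwd L = iota M ⊠s id1 a by rewrite -cmpA inv_comp cmpm1.
have sj : sq_src j = bwd L0.
  apply: (iso_cancel (fwd_iso L0)); rewrite inv_comp -sL.
  by apply: etrans (esym (fmapD (srcF D) j (fwd L))) _; rewrite jL; case: gia.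
have tj : sq_tgt j = bwd L0.
  apply: (iso_cancel (fwd_iso L0)); rewrite inv_comp -tL.
  by apply: etrans (esym (fmapD (tgtF D) j (fwd L))) _; rewrite jL; case: gia.
split=> //.
- move=> e.
  have eL : sq_tgt (fwd L) = sq_src (fwd L) by rewrite sL tL.
  have ei : sq_tgt (iota M) = sq_src (iota M) by apply: glob_match.
  have ea := match1 a a.
  have eia := glob_match gia gia.
  pose LL := tlunit (M1 M) (Hob (a ⊙ a)).
  have H : hc j j e ∘ fwd LL =
      xi M (hid (ounit M)) (hid (ounit M)) a a ∘ ((hc (iota M) (iota M) ei ∘ delta M) ⊠s id1 (a ⊙ a)).
    rewrite -(tlunit_xi V eL) !cmpA hc_cmp.
    rewrite (hc_ext _ eia jL jL) -(xi_nat Y ei ea eia) (hc1 D) -!cmpA.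
    by rewrite stensD cmp1m.
  have K : hlunit (hid (ounit M)) ∘ (hc (iota M) (iota M) ei ∘ delta M) = iota M.
    have e1 : sq_tgt (iota M) = sq_src (id1 (hid (ounit M))).
      by apply: glob_match => //; exact: hid_glob.
    have gu : globular (id1 (hunit M)) by split; rewrite fmap1.
    have e2 : sq_tgt (id1 (hunit M)) = sq_src (iota M) by apply: glob_match.
    have -> : hc (iota M) (iota M) ei = hc (id1 _) (iota M) e1 ∘ hc (iota M) (id1 _) e2.
      by rewrite hc_cmp; apply: hc_ext; rewrite ?cmp1m ?cmpm1.
    have e3 : sq_tgt (iota M) = sq_src (fmap (hidF D) (idm (ounit M))).
      by rewrite (hid_src D); case: gi.
    rewrite -(hc_ext e3 e1 (fmap1 (hidF D) _) erefl) !cmpA hlunit_nat'; last by case: gi.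
    by rewrite -!cmpA [X in _ ∘ X]cmpA (delta_counitl U) cmpm1.
  apply: (iso_cancel (fwd_iso LL)); rewrite -!cmpA H /=.
  rewrite (cmpA (inv _)) inv_comp cmp1m stensD K cmpm1.
  have := tlunit_nat (M1 M) (mu (mstr m)); rewrite -/LL -/L => R.
  rewrite -R (cmpA (bwd L)) inv_comp cmp1m.
  by rewrite stensD cmp1m cmpm1.
- pose LL := tlunit (M1 M) (Hob (hid (mob m))).
  have R := tlunit_nat (M1 M) (eta (mstr m)); rewrite -/L -/LL in R.
  apply: (iso_cancel (fwd_iso LL)); rewrite /j /=.
  rewrite -!cmpA -R (cmpA (bwd L)) inv_comp cmp1m stensD cmp1m cmpm1.
  have -> : fwd LL = fmap (hidF D) (fwd L0) ∘ upsilon M (ounit M) (mob m)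
      ∘ (iota M ⊠s id1 (hid (mob m))) by rewrite (tlunit_upsilon V).
  rewrite -!cmpA (cmpA (fmap (hidF D) (bwd L0))).
  rewrite -(fmapD (hidF D) (bwd L0) (fwd L0)) inv_comp fmap1 cmp1m.
  by rewrite (cmpA (inv _)) inv_comp cmp1m stensD cmp1m cmpm1.
Qed.

(** The composite E o_1 F of a binary E : h, b -> c with F : G -> h. When G is
    empty, the domain b of the composite is identified with I ⊠ b by the unit
    constraints, and I_1 with id_I by iota. *)
Section Composition.
Variables (h b c : monad D) (E : multimorphism (Some (Snoc (One h) b)) c).

Definition ev_map : hom (mob h ⊠ mob b) (mob c) := mm_map E.
Definition ev_cell1 : mcar h ⊠h hid (mob b) ⇒ mcar c := @mm_cell _ _ E (Some tt).
Definition ev_cell2 : hid (mob h) ⊠h mcar b ⇒ mcar c := @mm_cell _ _ E None.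

Definition comp1_map (G : inputs) :
    hom (dom_obj G) (mob h) -> hom (dom_obj (append G b)) (mob c) :=
  match G with
  | Some G' => fun f => ev_map ∘ (f ⊠v idm (mob b))
  | None => fun f => ev_map ∘ (f ⊠v idm (mob b)) ∘ bwd (tlunit (M0 M) (mob b))
  end.

Definition comp1_cell (G : inputs) : forall f : hom (dom_obj G) (mob h),
    (forall p : input_pos G, input_slot p ⇒ mcar h) ->
    forall p : input_pos (append G b), input_slot p ⇒ mcar c :=
  match G with
  | Some G' => fun f phi p =>
      match p return @input_slot (append (Some G') b) p ⇒ mcar c with
      | Some q => ev_cell1 ∘ (phi q ⊠s id1 (hid (mob b)))
      | None => ev_cell2 ∘ (fmap (hidF D) f ⊠s id1 (mcar b))
                  ∘ (disc_norm G' ⊠s id1 (mcar b))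
      end
  | None => fun f _ _ =>
      ev_cell2 ∘ (fmap (hidF D) f ⊠s id1 (mcar b)) ∘ (iota M ⊠s id1 (mcar b))
        ∘ bwd (tlunit (M1 M) (Hob (mcar b)))
  end.

Lemma comp1_monad_map (G : inputs) (F : multimorphism G h) p :
  is_mnd_map (@input_str (append G b) p) (mstr c)
    (comp1_map (mm_map F)) (comp1_cell (mm_map F) (@mm_cell _ _ F) p).
Proof.
have E1 : is_mnd_map (tens_str (mstr h) (discr_str (mob b))
    (xi_iso_r N (mob b) (mcar h) (mcar h))) (mstr c) ev_map ev_cell1.
  exact: (@mm_monad_map _ _ E (Some tt)).
have E2 : is_mnd_map (tens_str (discr_str (mob h)) (mstr b)
    (xi_disc (One h) b)) (mstr c) ev_map ev_cell2.
  exact: (@mm_monad_map _ _ E None).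
case: G F p => [G|] F p.
- case: p => [q|] /=.
  + apply: (@is_mnd_map_comp D _ _ _ _ _ _ _ _ _ _ _ _ _ E1).
    apply: tens_map (is_mnd_map_id _).
    exact: (mm_monad_map F q).
  + have I1 := is_mnd_map_id (mstr b).
    have H1 := tens_map (xi_disc G b) (xi_iso_l N _ _ _) (disc_norm_map G) I1.
    have H2 := tens_map (xi_iso_l N _ _ _) (xi_disc (One h) b)
                 (discr_map (mm_map F)) I1.
    have := is_mnd_map_comp (is_mnd_map_comp E2 H2) H1.
    by rewrite tmor1 cmpm1.
- have I1 := is_mnd_map_id (mstr b).
  have H2 := tens_map (xi_iso_l N _ _ _) (xi_disc (One h) b)
               (discr_map (mm_map F)) I1.
  have := is_mnd_map_comp (is_mnd_map_comp E2 H2) (lunit_map b).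
  by rewrite /= -!cmpA.
Qed.

Definition comp1 (G : inputs) (F : multimorphism G h) :
    multimorphism (append G b) c :=
  Multimorphism (comp1_monad_map F).

End Composition.

End Tensor.

(* Main.v *)
From Stdlib Require Import ProofIrrelevance FunctionalExtensionality ClassicalEpsilon.
From mathcomp Require Import all_boot.
Require Import Defs.

Set Implicit Arguments.
Unset Strict Implicit.
Unset Printing Implicit Defensive.

(** Write (B, b), (C, c) for the given monads. A multimorphism A_1, ..., A_n, B -> C
    consists of a monad map id_A ⊠ b -> c over f : A ⊠ B -> C, where
    A = A_1 ⊠ ... ⊠ A_n, and of monad maps a'_i ⊠ id_B -> c over f, where a'_i is
    the i-th slot on A. The two kinds of data are represented separately.

    By closedness and 1-tabulators, 2-morphisms id_A ⊠ b -> c correspond to vertical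
    maps from A to the tabulator of <b, c>. That both boundaries agree, and that the
    2-morphism is a monad map, are equations between maps of this kind, since
    (id_A ⊠ b) ⊙ (id_A ⊠ b) is isomorphic to id_A ⊠ (b ⊙ b) by normality. So an
    iterated equaliser H in C_0 represents the pairs (f, monad map id_A ⊠ b -> c);
    let e : H ⊠ B -> C be the universal f.

    The restriction h of <id_B, c> along the transpose of e represents the
    2-morphisms x ⊠ id_B -> c lying over maps that factor through e. The monad
    structure of c induces one on h, for which 2-morphisms x -> h are monad maps
    exactly when the corresponding x ⊠ id_B -> c are. *)

(** * Adjoint transposes and representable subfunctors *)

Section Categories.
Variable C : category.

Lemma adj_transpose (D : category) (L : C -> D) (R : D -> C)
  (LF : functorial L) (RF : functorial R) (adj : adjunction LF RF)
  (x : C) (y : D) (f : hom (L x) y) :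
  exists! k : hom x (R y), adj_counit adj y ∘ fmap LF k = f.
Proof.
exists (fmap RF f ∘ adj_unit adj x); split.
  by rewrite fmapD cmpA adj_counit_nat -cmpA adj_triangle_l cmpm1.
move=> k <-.
by rewrite fmapD -cmpA -adj_unit_nat cmpA adj_triangle_r cmp1m.
Qed.

Definition mono (x y : C) (i : hom x y) : Prop :=
  forall (z : C) (k k' : hom z x), i ∘ k = i ∘ k' -> k = k'.

(** For [P] stable under precomposition, this says that the subobject [i] represents [P] as a
    subfunctor of the maps into [x]; uniqueness of factorisations is [mono i]. *)
Definition representable_sub (x : C) (P : forall z : C, hom z x -> Prop) : Prop :=
  exists (e : C) (i : hom e x),
    [/\ mono i, P e i & forall (z : C) (h : hom z x), P z h -> exists k, i ∘ k = h].

Lemma representable_eq (E : has_equalisers C) (x y : C) (f g : hom x y) :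
  representable_sub (fun z (h : hom z x) => f ∘ h = g ∘ h).
Proof.
have [e [i [fi U]]] := E _ _ f g; exists e, i; split=> //.
- move=> z k k' H; have fk : f ∘ (i ∘ k) = g ∘ (i ∘ k) by rewrite !cmpA fi.
  have [k0 [_ u]] := U _ _ fk.
  by rewrite -(u k erefl) -(u k' (esym H)).
- by move=> z h /U [k [ik _]]; exists k.
Qed.

Lemma representable_iff (x : C) (P Q : forall z : C, hom z x -> Prop) :
  (forall z h, P z h <-> Q z h) -> representable_sub P -> representable_sub Q.
Proof.
move=> PQ [e [i [m p f]]]; exists e, i; split=> //; first exact/PQ.
by move=> z h /PQ; exact: f.
Qed.

Lemma iso_cancel_l (x y z : C) (f : hom x y) (i : is_iso f) (g h : hom z x) :
  f ∘ g = f ∘ h -> g = h.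
Proof.
by move=> e; rewrite -(cmp1m g) -(cmp1m h) -(inv_comp i) -!cmpA e.
Qed.

End Categories.

Lemma inj_surj_bijective (T U : Type) (f : T -> U) :
  injective f -> (forall u, exists t, f t = u) -> bijective f.
Proof.
move=> inj surj; pose g u := proj1_sig (constructive_indefinite_description _ (surj u)).
have fg u : f (g u) = u by rewrite /g; case: constructive_indefinite_description.
by exists g => // t; apply: inj; rewrite fg.
Qed.

(** * Unit coherence for horizontal composition *)

Section UnitCoherence.
Variables (D : dbl_cat) (A : C0 D).
Local Notation I := (@hid D A).

Lemma glob_hc (A' B' C' : C0 D) (y y' : hor B' C') (x x' : hor A' B')
  (beta : y ⇒ y') (alpha : x ⇒ x') e :
  globular beta -> globular alpha -> globular (hc beta alpha e).
Proof. by move=> [s t] [s' t']; split; rewrite ?(hc_src D) ?(hc_tgt D). Qed.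

Lemma glob1 (A' B' : C0 D) (x : hor A' B') : globular (id1 x).
Proof. by split; rewrite fmap1. Qed.

(** Naturality of [hlunit] conjugates composition with [I] into the identity operation, so this
    composition is faithful on globular cells. *)
Lemma hid_hc_inj (B' : C0 D) (x y : hor B' A) (alpha beta : x ⇒ y) e e' :
  globular alpha -> globular beta ->
  hc (id1 I) alpha e = hc (id1 I) beta e' -> alpha = beta.
Proof.
move=> [sa ta] [sb tb] H; apply: (iso_cancel (fwd_iso (hlunit x))).
have ea : sq_tgt alpha = sq_src (fmap (hidF D) (idm A)) by rewrite ta (hid_src D).
have eb : sq_tgt beta = sq_src (fmap (hidF D) (idm A)) by rewrite tb (hid_src D).
rewrite -(hlunit_nat' ea ta) -(hlunit_nat' eb tb).
rewrite (hc_ext ea e (fmap1 (hidF D) A) erefl).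
by rewrite (hc_ext eb e' (fmap1 (hidF D) A) erefl) H.
Qed.

Lemma hrunit_nat' A1 A2 B1 B2 (x : hor A1 B1) (x' : hor A2 B2) (alpha : x ⇒ x') g e :
  sq_src alpha = g ->
  hrunit x' ∘ hc alpha (fmap (hidF D) g) e = alpha ∘ hrunit x.
Proof. by move=> E; subst g; apply: (hrunit_nat D). Qed.

Lemma hc_hid_inj (B' : C0 D) (x y : hor A B') (alpha beta : x ⇒ y) e e' :
  globular alpha -> globular beta ->
  hc alpha (id1 I) e = hc beta (id1 I) e' -> alpha = beta.
Proof.
move=> [sa ta] [sb tb] H; apply: (iso_cancel (fwd_iso (hrunit x))).
have ea : sq_tgt (fmap (hidF D) (idm A)) = sq_src alpha by rewrite sa (hid_tgt D).
have eb : sq_tgt (fmap (hidF D) (idm A)) = sq_src beta by rewrite sb (hid_tgt D).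
rewrite -(hrunit_nat' ea sa) -(hrunit_nat' eb sb).
rewrite (hc_ext ea e erefl (fmap1 (hidF D) A)).
by rewrite (hc_ext eb e' erefl (fmap1 (hidF D) A)) H.
Qed.

(** By the pentagon for hid A, hid A, y, x and two triangles, both sides agree
    after composition with [hid A]. *)
Lemma hlunit_hcomp (B' C' : C0 D) (y : hor B' A) (x : hor C' B') e :
  hlunit (y ⊙ x) ∘ hassoc I y x = hc (hlunit y) (id1 x) e.
Proof.
have gL B1 (z : hor B1 A) : globular (hlunit z) by exact: (hlunit_glob D).
have gA (B1 B2 B3 B4 : C0 D) (z : hor B3 B4) (w : hor B2 B3) (v : hor B1 B2) :
  globular (hassoc z w v) by exact: (hassoc_glob D).
have gR : globular (hrunit I) by exact: (hrunit_glob D).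
have g1 := glob1.
have gla : globular (hlunit (y ⊙ x) ∘ hassoc I y x).
  case: (gL _ (y ⊙ x)) (gA _ _ _ _ I y x) => s t [s' t'].
  by split; rewrite fmapD ?s ?s' ?t ?t' cmp1m.
have glb := glob_hc e (gL _ y) (g1 _ _ x).
have m1 := glob_match (g1 _ _ I) gla.
have m2 := glob_match (g1 _ _ I) glb.
apply: (hid_hc_inj (e := m1) (e' := m2)) => //.
have m3 := glob_match (gA _ _ _ _ I I y) (g1 _ _ x).
apply: (iso_cancel (is_iso_cmp (fwd_iso (hassoc I (I ⊙ y) x))
  (is_iso_hc m3 (fwd_iso (hassoc I I y)) (is_iso_idm (Hob x : C1 D))))).
have m4 := glob_match (g1 _ _ I) (gL _ (y ⊙ x)).
have m5 := glob_match (g1 _ _ I) (gA _ _ _ _ I y x).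
rewrite -(hc_ext (match_cmp m4 m5) m1 (cmp1m (id1 I)) erefl) -(hc_cmp m4 m5).
rewrite -!cmpA [X in _ ∘ X]cmpA -(hpentagon D) !cmpA.
have m6 := glob_match gR (g1 _ _ (y ⊙ x)).
rewrite (htriangle D m4 m6).
have m7 := glob_match gR (g1 _ _ y).
have m8 := glob_match (glob_hc m7 gR (g1 _ _ y)) (g1 _ _ x).
have m11 : sq_tgt (hc (id1 y) (id1 x) (match1 y x)) = sq_src (hrunit I).
  by rewrite (hc1 D).
rewrite -(hc_ext m11 m6 erefl (hc1 D (match1 y x))).
rewrite -(hassoc_nat D m8 m11).
have m9 := glob_match (g1 _ _ I) (gL _ y).
have m10 := glob_match (glob_hc m9 (g1 _ _ I) (gL _ y)) (g1 _ _ x).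
rewrite -(hc_ext (match_cmp m10 m3) m8 (htriangle D m9 m7) (cmp1m _)) -(hc_cmp m10 m3).
by rewrite !cmpA (hassoc_nat D m10 m2).
Qed.

(** After composition with [I], [hlunit_hcomp] and the triangle reduce the claim to the equality of
    [hlunit (I ⊙ I)] with the composite of [id1 I] and [hlunit I], which is naturality of [hlunit]
    at [hlunit I]. The discrete monad multiplies by [hlunit], whereas [xi_runit] produces
    [hrunit]. *)
Lemma hlunit_hid : fwd (hlunit I) = fwd (hrunit I).
Proof.
have gL : globular (hlunit I) by exact: (hlunit_glob D).
have gR : globular (hrunit I) by exact: (hrunit_glob D).
have g1 := glob1.
have e := glob_match gL (g1 _ _ I); have e' := glob_match gR (g1 _ _ I).
apply: (hc_hid_inj (e := e) (e' := e')) => //.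
have e2 := glob_match (g1 _ _ I) gL.
rewrite -(hlunit_hcomp e) -(htriangle D e2 e').
congr (_ ∘ _); apply: (iso_cancel_l (fwd_iso (hlunit I))).
have e3 : sq_tgt (hlunit I) = sq_src (fmap (hidF D) (idm A)).
  by rewrite (hid_src D); case: gL.
rewrite -(hlunit_nat' e3 (proj2 gL)).
by congr (_ ∘ _); apply: hc_ext; rewrite ?fmap1.
Qed.

End UnitCoherence.

(** * Monad maps out of tensor products *)

Section Tensor.
Variables (D : dbl_cat) (M : oplax_monoidal D) (N : normal M).

Local Notation "A ⊠ B" := (A ⊠[M] B) (at level 38, left associativity).
Local Notation "x ⊠h y" := (x ⊠h[M] y) (at level 38, left associativity).
Local Notation "f ⊠v g" := (f ⊠v[M] g) (at level 38, left associativity).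
Local Notation "a ⊠s b" := (a ⊠s[M] b) (at level 38, left associativity).

Lemma vtensD (A A' A'' B B' B'' : C0 D) (f' : hom A' A'') (f : hom A A')
  (g' : hom B' B'') (g : hom B B') :
  (f' ⊠v g') ∘ (f ⊠v g) = (f' ∘ f) ⊠v (g' ∘ g).
Proof. by symmetry; exact: tmorD. Qed.

Lemma stens1 (A A' B B' : C0 D) (x : hor A A') (y : hor B B') :
  id1 x ⊠s id1 y = id1 (x ⊠h y).
Proof. exact: tmor1. Qed.

Lemma src_stens (A A' B B' E E' F F' : C0 D) (x : hor A A') (x' : hor B B')
  (y : hor E E') (y' : hor F F') (alpha : x ⇒ x') (beta : y ⇒ y') :
  @fmap _ _ _ (srcF D) (Hob (x ⊠h y)) (Hob (x' ⊠h y')) (alpha ⊠s beta) =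
  sq_src alpha ⊠v sq_src beta.
Proof. exact: (tens_src (oplax_strict M) alpha beta). Qed.

Lemma tgt_stens (A A' B B' E E' F F' : C0 D) (x : hor A A') (x' : hor B B')
  (y : hor E E') (y' : hor F F') (alpha : x ⇒ x') (beta : y ⇒ y') :
  @fmap _ _ _ (tgtF D) (Hob (x ⊠h y)) (Hob (x' ⊠h y')) (alpha ⊠s beta) =
  sq_tgt alpha ⊠v sq_tgt beta.
Proof. exact: (tens_tgt (oplax_strict M) alpha beta). Qed.

Lemma tens_match (A1 A1' B1 B1' E1 E1' A2 A2' B2 B2' E2 E2' : C0 D)
  (x1 : hor A1 B1) (x1' : hor A1' B1') (y1 : hor B1 E1) (y1' : hor B1' E1')
  (x2 : hor A2 B2) (x2' : hor A2' B2') (y2 : hor B2 E2) (y2' : hor B2' E2')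
  (alpha1 : x1 ⇒ x1') (beta1 : y1 ⇒ y1') (alpha2 : x2 ⇒ x2') (beta2 : y2 ⇒ y2') :
  sq_tgt alpha1 = sq_src beta1 -> sq_tgt alpha2 = sq_src beta2 ->
  @fmap _ _ _ (tgtF D) (Hob (x1 ⊠h x2)) (Hob (x1' ⊠h x2')) (alpha1 ⊠s alpha2) =
  @fmap _ _ _ (srcF D) (Hob (y1 ⊠h y2)) (Hob (y1' ⊠h y2')) (beta1 ⊠s beta2).
Proof. by move=> e1 e2; rewrite tgt_stens src_stens e1 e2. Qed.

(** Moving the inverses of [xi] and [upsilon] to the other side leaves conditions that do not
    mention [i], so the chosen inverse of [xi] is irrelevant. *)
Lemma tens_mnd_mapP (A B C : C0 D) (a : hor A A) (b : hor B B) (c : hor C C)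
  (Sa : mnd_str a) (Sb : mnd_str b) (Sc : mnd_str c) i (f : hom (A ⊠ B) C)
  (phi : a ⊠h b ⇒ c) :
  is_mnd_map (tens_str N Sa Sb i) Sc f phi <->
  [/\ sq_src phi = f, sq_tgt phi = f,
      forall e, phi ∘ (mu Sa ⊠s mu Sb) = mu Sc ∘ hc phi phi e ∘ xi M a a b b &
      phi ∘ (eta Sa ⊠s eta Sb) = eta Sc ∘ fmap (hidF D) f ∘ upsilon M A B].
Proof.
split=> [[s t m u]|[s t m u]]; split=> //.
- by move=> e; rewrite -m /= -!cmpA inv_comp cmpm1.
- by rewrite -u /= -!cmpA inv_comp cmpm1.
- by move=> e; apply: (iso_cancel i); rewrite -m /= -!cmpA inv_comp cmpm1.
- apply: (iso_cancel (upsilon_iso N A B)); rewrite -u /= -!cmpA inv_comp cmpm1 //.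
Qed.

Lemma inv_mnd_map (A B : C0 D) (a : hor A A) (b : hor B B) (Sa : mnd_str a)
  (Sb : mnd_str b) (f : hom A B) (phi : a ⇒ b) (i : is_iso f) (j : is_iso phi) :
  is_mnd_map Sa Sb f phi -> is_mnd_map Sb Sa (inv i) (inv j).
Proof.
case=> s t m u.
have s' : sq_src (inv j) = inv i.
  apply: (iso_cancel i); rewrite inv_comp -s.
  by have := fmapD (srcF D) (inv j) phi; rewrite inv_comp fmap1.
have t' : sq_tgt (inv j) = inv i.
  apply: (iso_cancel i); rewrite inv_comp -t.
  by have := fmapD (tgtF D) (inv j) phi; rewrite inv_comp fmap1.
split=> //.
- move=> e; have e' : sq_tgt phi = sq_src phi by rewrite s t.
  apply: (iso_cancel_l j); rewrite !cmpA comp_inv cmp1m (m e') -cmpA hc_cmp.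
  by rewrite (hc_ext _ (match1 b b) (comp_inv j) (comp_inv j)) (hc1 D) cmpm1.
- apply: (iso_cancel_l j); rewrite !cmpA comp_inv cmp1m u -cmpA.
  have := fmapD (hidF D) f (inv i); rewrite comp_inv fmap1 => <-.
  by rewrite cmpm1.
Qed.

(** * Transposition and universal cells *)

Section Closed.
Variable K : closed_dbl M.

Local Notation ev0 B C := (adj_counit (ihom0_adj K B) C).
Local Notation ev1 y z := (adj_counit (ihom1_adj K (Hob y)) (Hob z)).

Lemma ev0_transpose (A B C : C0 D) (f : hom (A ⊠ B) C) :
  exists! k : hom A (ihom0 K B C), ev0 B C ∘ (k ⊠v idm B) = f.
Proof. exact: (adj_transpose (ihom0_adj K B)). Qed.

Lemma ev1_transpose (A A' B B' C C' : C0 D) (x : hor A A') (y : hor B B')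
  (z : hor C C') (alpha : x ⊠h y ⇒ z) :
  exists! k : x ⇒ ihom1 K y z, ev1 y z ∘ (k ⊠s id1 y) = alpha.
Proof. exact: (adj_transpose (ihom1_adj K (Hob y)) (x := Hob x) (y := Hob z) alpha). Qed.

Lemma ev0_inj (A B C : C0 D) (k k' : hom A (ihom0 K B C)) :
  ev0 B C ∘ (k ⊠v idm B) = ev0 B C ∘ (k' ⊠v idm B) -> k = k'.
Proof.
move=> e; have [k0 [_ u]] := ev0_transpose (ev0 B C ∘ (k' ⊠v idm B)).
by rewrite -(u k e) -(u k').
Qed.

Lemma ev1_inj (A A' B B' C C' : C0 D) (x : hor A A') (y : hor B B')
  (z : hor C C') (k k' : x ⇒ ihom1 K y z) :
  ev1 y z ∘ (k ⊠s id1 y) = ev1 y z ∘ (k' ⊠s id1 y) -> k = k'.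
Proof.
move=> e; have [k0 [_ u]] := ev1_transpose (ev1 y z ∘ (k' ⊠s id1 y)).
by rewrite -(u k e) -(u k').
Qed.

(** Cartesianness of the transpose [h ⇒ ihom1 K y z] of [eps], rewritten through the adjunction: [h]
    is the restriction of the internal hom along the transposed boundaries of [eps]. *)
Definition universal_cell (H H' B B' C C' : C0 D) (h : hor H H') (y : hor B B')
    (z : hor C C') (eps : h ⊠h y ⇒ z) : Prop :=
  forall (X X' : C0 D) (x : hor X X') (alpha : x ⊠h y ⇒ z)
      (u : hom X H) (v : hom X' H'),
    sq_src alpha = sq_src eps ∘ (u ⊠v idm B) ->
    sq_tgt alpha = sq_tgt eps ∘ (v ⊠v idm B') ->
    exists! chi : x ⇒ h,
      [/\ sq_src chi = u, sq_tgt chi = v & eps ∘ (chi ⊠s id1 y) = alpha].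

(** A cartesian lift of [ihom1 K y z] along the transposes of [f] and [g] works: evaluation cells
    lie over evaluation maps, so the boundaries of a transpose are the transposes of the
    boundaries. *)
Lemma universal_cell_exists (HI : fibrant D) (H H' B B' C C' : C0 D)
  (y : hor B B') (z : hor C C') (f : hom (H ⊠ B) C) (g : hom (H' ⊠ B') C') :
  exists (h : hor H H') (eps : h ⊠h y ⇒ z),
    [/\ sq_src eps = f, sq_tgt eps = g & universal_cell eps].
Proof.
have [p [pf _]] := ev0_transpose f; have [q [qg _]] := ev0_transpose g.
have [h [theta [st tt cart]]] := HI _ _ _ _ (ihom1 K y z) p q.
have es : sq_src (ev1 y z) = ev0 B C by exact: ev_src.
have et : sq_tgt (ev1 y z) = ev0 B' C' by exact: ev_tgt.
exists h, (ev1 y z ∘ (theta ⊠s id1 y)).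
have sf : sq_src (ev1 y z ∘ (theta ⊠s id1 y) : h ⊠h y ⇒ z) = f.
  by rewrite fmapD es src_stens st fmap1.
have tg : sq_tgt (ev1 y z ∘ (theta ⊠s id1 y) : h ⊠h y ⇒ z) = g.
  by rewrite fmapD et tgt_stens tt fmap1.
split=> // X X' x alpha u v; rewrite sf tg => sa ta.
have [k [ka _]] := ev1_transpose alpha.
have sk : sq_src k = sq_src theta ∘ u.
  apply: ev0_inj; rewrite st -[idm B]cmp1m -vtensD cmpA pf -sa -ka.
  by rewrite fmapD src_stens es fmap1 cmp1m.
have tk : sq_tgt k = sq_tgt theta ∘ v.
  apply: ev0_inj; rewrite tt -[idm B']cmp1m -vtensD cmpA qg -ta -ka.
  by rewrite fmapD tgt_stens et fmap1 cmp1m.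
have [chi [[su tv ck] uniq]] := cart _ _ x k u v sk tk.
exists chi; split; first split=> //.
  by rewrite -cmpA stensD ck cmp1m.
move=> chi' [su' tv' ck']; apply: uniq; split=> //.
by apply: ev1_inj; rewrite ka -ck' -cmpA stensD cmp1m.
Qed.

(** * The monad structure induced on a universal cell *)

Section UniversalMonad.
Variables (H B C : C0 D) (c : hor C C) (Sc : mnd_str c) (Lc : mnd_laws Sc).
Variables (h : hor H H) (eps : h ⊠h hid B ⇒ c) (U : universal_cell eps).
Hypothesis ee : sq_tgt eps = sq_src eps.

Local Notation I := (@hid D B).

(** Allowing an isomorphism [t] in place of [id1 I] permits testing against the multiplications of
    the discrete monad, where iterated composites of [I] occur. *)
Lemma universal_cell_inj (X X' : C0 D) (x : hor X X') (w : hor B B)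
  (t : w ⇒ I) (chi chi' : x ⇒ h) :
  is_iso t -> sq_src chi = sq_src chi' -> sq_tgt chi = sq_tgt chi' ->
  eps ∘ (chi ⊠s t) = eps ∘ (chi' ⊠s t) -> chi = chi'.
Proof.
move=> it es et E0.
have E1 : eps ∘ (chi ⊠s id1 I) = eps ∘ (chi' ⊠s id1 I).
  have i : is_iso (id1 x ⊠s t) by apply: is_iso_tmor it; exact: is_iso_idm.
  by apply: (iso_cancel i); rewrite -!cmpA !stensD !cmpm1 !cmp1m.
have [||chi0 [_ uniq]] := @U _ _ x (eps ∘ (chi' ⊠s id1 I)) (sq_src chi') (sq_tgt chi').
- by rewrite fmapD src_stens fmap1.
- by rewrite fmapD tgt_stens fmap1.
by rewrite -(uniq chi) // -(uniq chi').
Qed.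

Lemma universal_mu : exists m : h ⊙ h ⇒ h, globular m /\
  eps ∘ (m ⊠s hlunit I) = mu Sc ∘ hc eps eps ee ∘ xi M h h I I.
Proof.
have [sm tm] := mu_glob Lc.
have [sx tx] := xi_glob (oplax_tensor M) h h I I.
have [sl tl] := glob_inv (fwd_iso (hlunit I)) (hlunit_glob D I).
(* [xi] starts at the tensor with [I ⊙ I], so [I] is first expanded by the inverse unit
   constraint. *)
pose al : (h ⊙ h) ⊠h I ⇒ c := mu Sc ∘ hc eps eps ee ∘ xi M h h I I
  ∘ (id1 (h ⊙ h) ⊠s bwd (hlunit I)).
have [||m [[s t E] _]] := @U _ _ (h ⊙ h) al (idm H) (idm H).
- by rewrite !fmapD src_stens sm sx sl (hc_src D) fmap1 cmp1m cmpm1.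
- by rewrite !fmapD tgt_stens tm tx tl (hc_tgt D) fmap1 cmp1m cmpm1.
exists m; split=> //.
have := stensD M m (id1 (h ⊙ h)) (id1 I) (hlunit I); rewrite cmpm1 cmp1m => <-.
by rewrite cmpA E /al -!cmpA stensD inv_comp cmp1m stens1 cmpm1.
Qed.

Lemma universal_eta : exists n : hid H ⇒ h, globular n /\
  eps ∘ (n ⊠s id1 I) = eta Sc ∘ fmap (hidF D) (sq_src eps) ∘ upsilon M H B.
Proof.
have [sn tn] := eta_glob Lc.
have [su tu] := upsilon_glob (oplax_tensor M) H B.
have [||n [[s t E] _]] := @U _ _ (hid H)
  (eta Sc ∘ fmap (hidF D) (sq_src eps) ∘ upsilon M H B) (idm H) (idm H).
- by rewrite !fmapD sn su (hid_src D) tmor1 cmp1m.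
- by rewrite !fmapD tn tu (hid_tgt D) tmor1 cmp1m ee.
by exists n.
Qed.

(** Naturality of [xi] and interchange give this formula, which carries each law for [m] over to the
    corresponding law of [c]. *)
Lemma universal_mu_hc (m : h ⊙ h ⇒ h) :
  eps ∘ (m ⊠s hlunit I) = mu Sc ∘ hc eps eps ee ∘ xi M h h I I ->
  forall (X X' X'' E E' E'' : C0 D) (y : hor X' X'') (x : hor X X')
    (y' : hor E' E'') (x' : hor E E') (p : y ⇒ h) (q : x ⇒ h)
    (p' : y' ⇒ I) (q' : x' ⇒ I) e e' et,
  eps ∘ ((m ∘ hc p q e) ⊠s (hlunit I ∘ hc p' q' e')) =
  mu Sc ∘ hc (eps ∘ (p ⊠s p')) (eps ∘ (q ⊠s q')) et ∘ xi M x y x' y'.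
Proof.
move=> Em X X' X'' E E' E'' y x y' x' p q p' q' e e' et.
have ep := tens_match e e'.
rewrite -stensD cmpA Em -!cmpA (xi_nat (oplax_tensor M) e e' ep).
by rewrite (hcD D et ee ep) -!cmpA.
Qed.

(** Both sides of each law have equal boundaries, so [universal_cell_inj] lets them be compared
    under [eps]. There they become the laws of [c], by the coherence of [xi] with associativity and
    units. *)
Lemma universal_monad : exists S : mnd_str h,
  [/\ mnd_laws S,
      eps ∘ (mu S ⊠s hlunit I) = mu Sc ∘ hc eps eps ee ∘ xi M h h I I &
      eps ∘ (eta S ⊠s id1 I) =
        eta Sc ∘ fmap (hidF D) (sq_src eps) ∘ upsilon M H B].
Proof.
have Y := oplax_tensor M.
have [m [gm Em]] := universal_mu; have [n [gn En]] := universal_eta.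
have [sm tm] := gm; have [sn tn] := gn.
have mhc := universal_mu_hc Em.
have gI := hid_glob B.
have gl := hlunit_glob D I; have il := fwd_iso (hlunit I).
have [smu tmu] := mu_glob Lc; have [set_ tet] := eta_glob Lc.
have [sxi txi] := xi_glob Y h h I I; have [sup tup] := upsilon_glob Y H B.
have e2I : sq_tgt (id1 I) = sq_src (hlunit I) by apply: glob_match.
have e1I : sq_tgt (hlunit I) = sq_src (id1 I) by apply: glob_match.
have e0 := match1 I I.
have emul : eps ∘ (id1 h ⊠s id1 I) = eps by rewrite stens1 cmpm1.
(* Associativity of the discrete monad on [B], which acts in the second tensor factor. *)
have lI : hc (hlunit I) (id1 I) e2I = hc (id1 I) (hlunit I) e1I ∘ hassoc I I I.
  have e3 : sq_tgt (id1 I) = sq_src (hrunit I) by rewrite -hlunit_hid.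
  rewrite (htriangle D e1I e3); apply: hc_ext => //; exact: hlunit_hid.
(* This gives the second factor the shape that [universal_mu_hc] expects in the unit laws. *)
have l1 : fwd (hlunit I) = hlunit I ∘ hc (id1 I) (id1 I) e0.
  by rewrite (hc1 D) cmpm1.
exists (MndStr m n); split=> //; split=> //=.
- move=> e1 e2.
  have it : is_iso (hlunit I ∘ hc (hlunit I) (id1 I) e2I).
    by apply: (is_iso_cmp il); apply: (is_iso_hc _ il); exact: is_iso_idm.
  apply: (universal_cell_inj it).
  + by rewrite !fmapD !(hc_src D) sm fmap1 (proj1 (hassoc_glob D h h h)) !cmpm1.
  + by rewrite !fmapD !(hc_tgt D) tm fmap1 (proj2 (hassoc_glob D h h h)) !cmpm1.
  have m1 : sq_tgt eps = sq_src (mu Sc ∘ hc eps eps ee ∘ xi M h h I I).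
    by rewrite !fmapD (hc_src D) smu sxi cmp1m cmpm1.
  have m2 : sq_tgt (mu Sc ∘ hc eps eps ee ∘ xi M h h I I) = sq_src eps.
    by rewrite !fmapD (hc_tgt D) tmu txi cmp1m cmpm1.
  have a1 : sq_tgt (id1 c) = sq_src (mu Sc) by rewrite fmap1 smu.
  have a2 : sq_tgt eps = sq_src (hc eps eps ee) by rewrite (hc_src D).
  have a3 : sq_tgt (id1 (h ⊠h I)) = sq_src (xi M h h I I) by rewrite fmap1 sxi.
  have b1 : sq_tgt (mu Sc) = sq_src (id1 c) by rewrite fmap1 tmu.
  have b2 : sq_tgt (hc eps eps ee) = sq_src eps by rewrite (hc_tgt D).
  have b3 : sq_tgt (xi M h h I I) = sq_src (id1 (h ⊠h I)) by rewrite fmap1 txi.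
  have n1 : sq_tgt (eps ∘ (id1 h ⊠s id1 I)) = sq_src (eps ∘ (m ⊠s hlunit I)).
    by rewrite emul Em.
  have n2 : sq_tgt (eps ∘ (m ⊠s hlunit I)) = sq_src (eps ∘ (id1 h ⊠s id1 I)).
    by rewrite emul Em.
  rewrite (mhc _ _ _ _ _ _ _ _ _ _ _ _ _ _ e1 e2I n1) (hc_ext n1 m1 Em emul).
  rewrite lI cmpA -stensD cmpA.
  rewrite (mhc _ _ _ _ _ _ _ _ _ _ _ _ _ _ e2 e1I n2) (hc_ext n2 m2 emul Em).
  (* Interchange separates three layers, to which [muA], [hassoc_nat] and [xi_assoc] apply
     respectively. *)
  have -> : hc (mu Sc ∘ hc eps eps ee ∘ xi M h h I I) eps m1 =
      hc (mu Sc) (id1 c) a1 ∘ hc (hc eps eps ee) eps a2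
        ∘ hc (xi M h h I I) (id1 (h ⊠h I)) a3.
    by rewrite !hc_cmp; apply: hc_ext; rewrite ?cmp1m ?cmpm1.
  have -> : hc eps (mu Sc ∘ hc eps eps ee ∘ xi M h h I I) m2 =
      hc (id1 c) (mu Sc) b1 ∘ hc eps (hc eps eps ee) b2
        ∘ hc (id1 (h ⊠h I)) (xi M h h I I) b3.
    by rewrite !hc_cmp; apply: hc_ext; rewrite ?cmp1m ?cmpm1.
  have xa := xi_assoc Y a3 b3; rewrite -!cmpA in xa.
  rewrite !cmpA (muA Lc a1 b1) -!cmpA -xa !cmpA.
  by rewrite -(cmpA _ (hassoc c c c)) (hassoc_nat D a2 b2) !cmpA.
- move=> e; apply: (universal_cell_inj il).
  + by rewrite fmapD (hc_src D) sm fmap1 (proj1 (hlunit_glob D h)) cmp1m.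
  + by rewrite fmapD (hc_tgt D) tm tn (proj2 (hlunit_glob D h)) cmp1m.
  have m1 : sq_tgt eps =
      sq_src (eta Sc ∘ fmap (hidF D) (sq_src eps) ∘ upsilon M H B).
    by rewrite !fmapD (hid_src D) set_ sup cmp1m cmpm1.
  have n1 : sq_tgt (eps ∘ (id1 h ⊠s id1 I)) = sq_src (eps ∘ (n ⊠s id1 I)).
    by rewrite emul En.
  rewrite {1}l1 (mhc _ _ _ _ _ _ _ _ _ _ _ _ _ _ e e0 n1) (hc_ext n1 m1 En emul).
  have a1 : sq_tgt (id1 c) = sq_src (eta Sc) by rewrite fmap1 set_.
  have a2 : sq_tgt eps = sq_src (fmap (hidF D) (sq_src eps)) by rewrite (hid_src D).
  have a3 : sq_tgt (id1 (h ⊠h I)) = sq_src (upsilon M H B) by rewrite fmap1 sup.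
  have -> : hc (eta Sc ∘ fmap (hidF D) (sq_src eps) ∘ upsilon M H B) eps m1 =
      hc (eta Sc) (id1 c) a1 ∘ hc (fmap (hidF D) (sq_src eps)) eps a2
        ∘ hc (upsilon M H B) (id1 (h ⊠h I)) a3.
    by rewrite !hc_cmp; apply: hc_ext; rewrite ?cmp1m ?cmpm1.
  by rewrite !cmpA (mu_etal Lc) hlunit_nat' // -!cmpA -(xi_lunit Y a3) !cmpA.
- move=> e; apply: (universal_cell_inj il).
  + by rewrite fmapD (hc_src D) sm sn (proj1 (hrunit_glob D h)) cmp1m.
  + by rewrite fmapD (hc_tgt D) tm fmap1 (proj2 (hrunit_glob D h)) cmp1m.
  have m1 : sq_tgt (eta Sc ∘ fmap (hidF D) (sq_src eps) ∘ upsilon M H B) =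
      sq_src eps.
    by rewrite !fmapD (hid_tgt D) tet tup cmp1m cmpm1.
  have n1 : sq_tgt (eps ∘ (n ⊠s id1 I)) = sq_src (eps ∘ (id1 h ⊠s id1 I)).
    by rewrite emul En.
  rewrite {1}l1 (mhc _ _ _ _ _ _ _ _ _ _ _ _ _ _ e e0 n1) (hc_ext n1 m1 emul En).
  have a1 : sq_tgt (eta Sc) = sq_src (id1 c) by rewrite fmap1 tet.
  have a2 : sq_tgt (fmap (hidF D) (sq_src eps)) = sq_src eps by rewrite (hid_tgt D).
  have a3 : sq_tgt (upsilon M H B) = sq_src (id1 (h ⊠h I)) by rewrite fmap1 tup.
  have -> : hc eps (eta Sc ∘ fmap (hidF D) (sq_src eps) ∘ upsilon M H B) m1 =
      hc (id1 c) (eta Sc) a1 ∘ hc eps (fmap (hidF D) (sq_src eps)) a2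
        ∘ hc (id1 (h ⊠h I)) (upsilon M H B) a3.
    by rewrite !hc_cmp; apply: hc_ext; rewrite ?cmp1m ?cmpm1.
  (* [xi_runit] leaves [hrunit I] in the second factor, while the test used [hlunit I]; [hlunit_hid]
     reconciles them. *)
  rewrite !cmpA (mu_etar Lc) hrunit_nat' // -!cmpA !(cmpA (hrunit _)).
  by rewrite (xi_runit Y) hlunit_hid.
Qed.

Lemma universal_mnd_map (S : mnd_str h) (A : C0 D) (a : hor A A) (Sa : mnd_str a)
  (g : hom A H) (phi : a ⇒ h) i :
  eps ∘ (mu S ⊠s hlunit I) = mu Sc ∘ hc eps eps ee ∘ xi M h h I I ->
  eps ∘ (eta S ⊠s id1 I) = eta Sc ∘ fmap (hidF D) (sq_src eps) ∘ upsilon M H B ->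
  globular (mu S) -> globular (eta S) -> globular (mu Sa) -> globular (eta Sa) ->
  sq_src phi = g -> sq_tgt phi = g ->
  is_mnd_map (tens_str N Sa (discr_str B) i) Sc (sq_src eps ∘ (g ⊠v idm B))
    (eps ∘ (phi ⊠s id1 I)) ->
  is_mnd_map Sa S g phi.
Proof.
move=> Em En [sm tm] [sn tn] [sma tma] [sna tna] s t /tens_mnd_mapP [sp tp m u].
split=> // [e|].
- apply: (universal_cell_inj (fwd_iso (hlunit I))).
  + by rewrite !fmapD (hc_src D) s sm sma cmp1m cmpm1.
  + by rewrite !fmapD (hc_tgt D) t tm tma cmp1m cmpm1.
  have et : sq_tgt (eps ∘ (phi ⊠s id1 I)) = sq_src (eps ∘ (phi ⊠s id1 I)).
    by rewrite sp tp.
  have := m et; rewrite -!cmpA stensD cmp1m => ->.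
  rewrite -(cmpm1 (fwd (hlunit I))) -(hc1 D (match1 I I)).
  by rewrite (universal_mu_hc Em e (match1 I I) et) -!cmpA.
- apply: (universal_cell_inj (is_iso_idm (Hob I : C1 D))).
  + by rewrite !fmapD (hid_src D) s sn sna cmp1m cmpm1.
  + by rewrite !fmapD (hid_tgt D) t tn tna cmp1m cmpm1.
  have := u; rewrite /= -!cmpA stensD cmp1m => ->.
  have := stensD M (eta S) (fmap (hidF D) g) (id1 I) (fmap (hidF D) (idm B)).
  rewrite fmap1 cmp1m => <-.
  rewrite (cmpA eps) En -!cmpA -(fmap1 (hidF D) B) (upsilon_nat (oplax_tensor M)).
  by rewrite fmapD -!cmpA.
Qed.

End UniversalMonad.

(** * Representing monad maps from a discrete monad tensored with [b] *)

Section Discrete.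
Hypotheses (HIII : has_equalisers (C0 D)) (HIV : has_1_tabulators D).

Lemma representable_vert (X B C : C0 D) (u v : hom (X ⊠ B) C) :
  representable_sub (fun Z (k : hom Z X) =>
    u ∘ (k ⊠v idm B) = v ∘ (k ⊠v idm B)).
Proof.
have [u' [<- _]] := ev0_transpose u; have [v' [<- _]] := ev0_transpose v.
apply: representable_iff (representable_eq HIII u' v') => Z k.
rewrite -!cmpA !vtensD cmp1m; split=> [->//|]; exact: ev0_inj.
Qed.

(** [X] is the tabulator of [ihom1 K y z]: cells transpose first to [hid Z ⇒ ihom1 K y z], then to
    vertical maps into [X]. Their boundaries are not prescribed. *)
Lemma discrete_cell_representable (B B' C C' : C0 D) (y : hor B B') (z : hor C C') :
  exists (X : C0 D) (kappa : hid X ⊠h y ⇒ z), forall Z (alpha : hid Z ⊠h y ⇒ z),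
    exists! k : hom Z X, kappa ∘ (fmap (hidF D) k ⊠s id1 y) = alpha.
Proof.
have [R [RF [adj]]] := HIV.
pose w : C1 D := Hob (ihom1 K y z).
exists (R w), (ev1 y z ∘ (adj_counit adj w ⊠s id1 y)) => Z alpha.
have [k [ka _]] := ev1_transpose alpha.
have [l [lk uniq]] := adj_transpose adj (x := Z) (y := w) k.
exists l; split; first by rewrite -cmpA stensD cmp1m lk.
move=> l' la; apply: uniq; apply: ev1_inj.
by rewrite ka -la -cmpA stensD cmp1m.
Qed.

(** By the preceding representation each equation becomes one between vertical maps out of [X]; two
    successive equalisers impose both. *)
Lemma representable_cell (X B1 B1' C1 C1' B2 B2' C2 C2' : C0 D)
  (y1 : hor B1 B1') (z1 : hor C1 C1') (y2 : hor B2 B2') (z2 : hor C2 C2')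
  (alpha1 beta1 : hid X ⊠h y1 ⇒ z1) (alpha2 beta2 : hid X ⊠h y2 ⇒ z2) :
  representable_sub (fun Z (k : hom Z X) =>
    alpha1 ∘ (fmap (hidF D) k ⊠s id1 y1) = beta1 ∘ (fmap (hidF D) k ⊠s id1 y1) /\
    alpha2 ∘ (fmap (hidF D) k ⊠s id1 y2) = beta2 ∘ (fmap (hidF D) k ⊠s id1 y2)).
Proof.
have [R1 [k1 U1]] := discrete_cell_representable y1 z1.
have [R2 [k2 U2]] := discrete_cell_representable y2 z2.
have [p1 [<- _]] := U1 _ alpha1; have [q1 [<- _]] := U1 _ beta1.
have [p2 [<- _]] := U2 _ alpha2; have [q2 [<- _]] := U2 _ beta2.
have I1 Z (k k' : hom Z R1) : k1 ∘ (fmap (hidF D) k ⊠s id1 y1) =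
    k1 ∘ (fmap (hidF D) k' ⊠s id1 y1) -> k = k'.
  move=> e; have [k0 [_ u]] := U1 _ (k1 ∘ (fmap (hidF D) k' ⊠s id1 y1)).
  by rewrite -(u k e) -(u k').
have I2 Z (k k' : hom Z R2) : k2 ∘ (fmap (hidF D) k ⊠s id1 y2) =
    k2 ∘ (fmap (hidF D) k' ⊠s id1 y2) -> k = k'.
  move=> e; have [k0 [_ u]] := U2 _ (k2 ∘ (fmap (hidF D) k' ⊠s id1 y2)).
  by rewrite -(u k e) -(u k').
have [E [i [mi ei fi]]] := representable_eq HIII p1 q1.
have [E' [i' [mi' ei' fi']]] := representable_eq HIII (p2 ∘ i) (q2 ∘ i).
have T1 Z (k : hom Z X) (p : hom X R1) :
    k1 ∘ (fmap (hidF D) p ⊠s id1 y1) ∘ (fmap (hidF D) k ⊠s id1 y1) =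
    k1 ∘ (fmap (hidF D) (p ∘ k) ⊠s id1 y1).
  by rewrite -!cmpA stensD cmp1m fmapD.
have T2 Z (k : hom Z X) (p : hom X R2) :
    k2 ∘ (fmap (hidF D) p ⊠s id1 y2) ∘ (fmap (hidF D) k ⊠s id1 y2) =
    k2 ∘ (fmap (hidF D) (p ∘ k) ⊠s id1 y2).
  by rewrite -!cmpA stensD cmp1m fmapD.
exists E', (i ∘ i'); split.
- by move=> Z k k'; rewrite -!cmpA => /mi /mi'.
- by rewrite !T1 !T2 !cmpA ei ei'.
- move=> Z k; rewrite !T1 !T2 => -[/I1 /fi [l <-] /I2].
  by rewrite !cmpA => /fi' [l' <-]; exists l'; rewrite cmpA.
Qed.

(** A 2-morphism on [hid Z ⊠ b] is a monad map iff two pairs of 2-morphisms out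
    of [hid Z ⊠ (b ⊙ b)] and [hid Z ⊠ hid B] agree, because
    [(hid Z ⊠ b) ⊙ (hid Z ⊠ b)] is isomorphic to the former by normality. *)
Lemma discrete_mnd_mapP (X Z B C : C0 D) (b : hor B B) (c : hor C C)
  (Sb : mnd_str b) (Sc : mnd_str c) (f : hom (X ⊠ B) C)
  (kappa : hid X ⊠h b ⇒ c) (e : sq_tgt kappa = sq_src kappa)
  (k : hom Z X) i :
  sq_src kappa = f ->
  is_mnd_map (tens_str N (discr_str Z) Sb i) Sc (f ∘ (k ⊠v idm B))
    (kappa ∘ (fmap (hidF D) k ⊠s id1 b)) <->
  (kappa ∘ (id1 (hid X) ⊠s mu Sb)) ∘ (fmap (hidF D) k ⊠s id1 (b ⊙ b)) =
  (mu Sc ∘ hc kappa kappa e ∘ xi M (hid X) (hid X) b b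
    ∘ (bwd (hlunit (hid X)) ⊠s id1 (b ⊙ b)))
    ∘ (fmap (hidF D) k ⊠s id1 (b ⊙ b)) /\
  (kappa ∘ (id1 (hid X) ⊠s eta Sb)) ∘ (fmap (hidF D) k ⊠s id1 (hid B)) =
  (eta Sc ∘ fmap (hidF D) f ∘ upsilon M X B)
    ∘ (fmap (hidF D) k ⊠s id1 (hid B)).
Proof.
move=> sf; have Y := oplax_tensor M.
have tf : sq_tgt kappa = f by rewrite e.
pose hk := fmap (hidF D) k.
have sk : sq_src hk = k by rewrite (hid_src D).
have tk : sq_tgt hk = k by rewrite (hid_tgt D).
have ek : sq_tgt hk = sq_src hk by rewrite sk.
have eb := match1 b b.
have et := tens_match ek eb.
(* Unit constraints reduce the composite of [hk] with itself to [hk], so the multiplication law can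
   be stated on [hid Z] instead of [hid Z ⊙ hid Z]. *)
have hlk : hc hk hk ek = bwd (hlunit (hid X)) ∘ hk ∘ hlunit (hid Z).
  apply: (iso_cancel_l (fwd_iso (hlunit (hid X)))).
  rewrite !cmpA comp_inv cmp1m; exact: (hlunit_nat' ek tk).
have xik : hc (hk ⊠s id1 b) (hk ⊠s id1 b) et ∘ xi M (hid Z) (hid Z) b b =
    xi M (hid X) (hid X) b b ∘ (bwd (hlunit (hid X)) ⊠s id1 (b ⊙ b))
      ∘ (hk ⊠s id1 (b ⊙ b)) ∘ (hlunit (hid Z) ⊠s id1 (b ⊙ b)).
  by rewrite -(xi_nat Y ek eb et) hlk (hc1 D) -!cmpA !stensD !cmp1m !cmpA.
have lmu : (kappa ∘ (hk ⊠s id1 b)) ∘ (hlunit (hid Z) ⊠s mu Sb) =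
    (kappa ∘ (id1 (hid X) ⊠s mu Sb)) ∘ (hk ⊠s id1 (b ⊙ b))
      ∘ (hlunit (hid Z) ⊠s id1 (b ⊙ b)).
  by rewrite -!cmpA !stensD !cmp1m !cmpm1.
have leta : (kappa ∘ (hk ⊠s id1 b)) ∘ (id1 (hid Z) ⊠s eta Sb) =
    (kappa ∘ (id1 (hid X) ⊠s eta Sb)) ∘ (hk ⊠s id1 (hid B)).
  by rewrite -!cmpA !stensD !cmp1m !cmpm1.
have reta : eta Sc ∘ fmap (hidF D) (f ∘ (k ⊠v idm B)) ∘ upsilon M Z B =
    (eta Sc ∘ fmap (hidF D) f ∘ upsilon M X B) ∘ (hk ⊠s id1 (hid B)).
  rewrite fmapD -!cmpA; congr (_ ∘ (_ ∘ _)).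
  by rewrite -(upsilon_nat Y) fmap1.
have rmu e' : mu Sc ∘ hc (kappa ∘ (hk ⊠s id1 b)) (kappa ∘ (hk ⊠s id1 b)) e'
      ∘ xi M (hid Z) (hid Z) b b =
    (mu Sc ∘ hc kappa kappa e ∘ xi M (hid X) (hid X) b b
      ∘ (bwd (hlunit (hid X)) ⊠s id1 (b ⊙ b))) ∘ (hk ⊠s id1 (b ⊙ b))
      ∘ (hlunit (hid Z) ⊠s id1 (b ⊙ b)).
  by rewrite (hcD D e' e et) -!cmpA xik !cmpA.
have sK : sq_src (kappa ∘ (hk ⊠s id1 b)) = f ∘ (k ⊠v idm B).
  by rewrite fmapD src_stens sk sf fmap1.
have tK : sq_tgt (kappa ∘ (hk ⊠s id1 b)) = f ∘ (k ⊠v idm B).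
  by rewrite fmapD tgt_stens tk tf fmap1.
have iZ : is_iso (hlunit (hid Z) ⊠s id1 (b ⊙ b)).
  by apply: is_iso_tmor; [exact: fwd_iso | exact: is_iso_idm].
rewrite tens_mnd_mapP; split=> [[_ _ m u]|[m u]].
- split; last by rewrite -leta -reta.
  have e' : sq_tgt (kappa ∘ (hk ⊠s id1 b)) = sq_src (kappa ∘ (hk ⊠s id1 b)).
    by rewrite sK tK.
  by apply: (iso_cancel iZ); rewrite -(rmu e') -(m e') /= lmu.
- split=> //; last by rewrite leta reta.
  by move=> e'; rewrite rmu lmu m.
Qed.

(** [H] is cut out of the tabulator by equalisers. Only [psi] has to be recovered from [k], since
    [f] is its source. *)
Lemma discrete_representable (b c : monad D) :
  exists (H : C0 D) (e : hom (H ⊠ mob b) (mob c)) (eps : hid H ⊠h mcar b ⇒ mcar c),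
    is_mnd_map (tens_str N (discr_str H) (mstr b) (xi_iso_l N H _ _)) (mstr c) e eps /\
    forall Z i (f : hom (Z ⊠ mob b) (mob c)) (psi : hid Z ⊠h mcar b ⇒ mcar c),
      is_mnd_map (tens_str N (discr_str Z) (mstr b) i) (mstr c) f psi ->
      exists! k : hom Z H, eps ∘ (fmap (hidF D) k ⊠s id1 (mcar b)) = psi.
Proof.
have [X [kappa U]] := discrete_cell_representable (mcar b) (mcar c).
have src_hk Y Z (k : hom Z Y) (al : hid Y ⊠h mcar b ⇒ mcar c) :
    sq_src (al ∘ (fmap (hidF D) k ⊠s id1 (mcar b))) = sq_src al ∘ (k ⊠v idm (mob b)).
  by rewrite fmapD src_stens (hid_src D) fmap1.
have tgt_hk Y Z (k : hom Z Y) (al : hid Y ⊠h mcar b ⇒ mcar c) :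
    sq_tgt (al ∘ (fmap (hidF D) k ⊠s id1 (mcar b))) = sq_tgt al ∘ (k ⊠v idm (mob b)).
  by rewrite fmapD tgt_stens (hid_tgt D) fmap1.
(* The boundaries are equalised first: the multiplication law involves [hc kappa1 kappa1], which
   requires them to agree. *)
have [X1 [i [mi ei fi]]] := representable_vert (sq_tgt kappa) (sq_src kappa).
pose kappa1 := kappa ∘ (fmap (hidF D) i ⊠s id1 (mcar b)) : hid X1 ⊠h mcar b ⇒ mcar c.
have e1 : sq_tgt kappa1 = sq_src kappa1 by rewrite tgt_hk src_hk.
have P Z k j := @discrete_mnd_mapP X1 Z _ _ _ _ (mstr b) (mstr c) _ kappa1 e1 k j erefl.
have [H [j [mj ej fj]]] := representable_cell
  (kappa1 ∘ (id1 (hid X1) ⊠s mu (mstr b)))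
  (mu (mstr c) ∘ hc kappa1 kappa1 e1 ∘ xi M (hid X1) (hid X1) (mcar b) (mcar b)
    ∘ (bwd (hlunit (hid X1)) ⊠s id1 (mcar b ⊙ mcar b)))
  (kappa1 ∘ (id1 (hid X1) ⊠s eta (mstr b)))
  (eta (mstr c) ∘ fmap (hidF D) (sq_src kappa1) ∘ upsilon M X1 (mob b)).
have hkD Z Z' Y (al : hid Y ⊠h mcar b ⇒ mcar c) (k : hom Z Y) (l : hom Z' Z) :
    al ∘ (fmap (hidF D) k ⊠s id1 (mcar b)) ∘ (fmap (hidF D) l ⊠s id1 (mcar b)) =
    al ∘ (fmap (hidF D) (k ∘ l) ⊠s id1 (mcar b)).
  by rewrite -!cmpA stensD cmp1m fmapD.
exists H, (sq_src kappa1 ∘ (j ⊠v idm (mob b))).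
exists (kappa1 ∘ (fmap (hidF D) j ⊠s id1 (mcar b))).
split; first exact/P.
move=> Z i' f psi mp.
have [k [kp uniq]] := U _ psi.
have [l il] : exists l, i ∘ l = k.
  by apply: fi; rewrite -src_hk -tgt_hk kp (mm_src mp) (mm_tgt mp).
have [l' jl] : exists l', j ∘ l' = l.
  apply: fj; apply/(P _ _ i').
  have kl : kappa1 ∘ (fmap (hidF D) l ⊠s id1 (mcar b)) = psi by rewrite hkD il.
  by rewrite kl -src_hk kl (mm_src mp).
exists l'; split; first by rewrite hkD jl hkD il.
move=> l2; rewrite hkD hkD => /uniq; rewrite -il -jl.
by move=> /mi /mj.
Qed.

End Discrete.
End Closed.

(** * Globularity of the slot structures, and equality of multimorphisms *)

Lemma tens_str_glob (A B : C0 D) (a : hor A A) (b : hor B B) (Sa : mnd_str a)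
  (Sb : mnd_str b) i :
  globular (mu Sa) /\ globular (eta Sa) -> globular (mu Sb) /\ globular (eta Sb) ->
  globular (mu (tens_str N Sa Sb i)) /\ globular (eta (tens_str N Sa Sb i)).
Proof.
move=> [ma na] [mb nb]; have Y := oplax_tensor M.
have [sm tm] := tens_glob M ma mb; have [sn tn] := tens_glob M na nb.
have [sx tx] := glob_inv i (xi_glob Y a a b b).
have [su tu] := glob_inv (upsilon_iso N A B) (upsilon_glob Y A B).
by split; split; rewrite /= fmapD ?sm ?tm ?sn ?tn ?sx ?tx ?su ?tu cmp1m.
Qed.

Lemma discr_str_glob (A : C0 D) :
  globular (mu (discr_str A)) /\ globular (eta (discr_str A)).
Proof. by split; [exact: (hlunit_glob D) | exact: hid_glob]. Qed.

Lemma disc_str_glob (G : ctx D) :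
  globular (mu (disc_str N G)) /\ globular (eta (disc_str N G)).
Proof.
elim: G => [m|G IH m] /=; first exact: discr_str_glob.
exact: tens_str_glob IH (discr_str_glob _).
Qed.

Lemma slot_str_glob (G : ctx D) (p : pos G) :
  globular (mu (slot_str N p)) /\ globular (eta (slot_str N p)).
Proof.
have mglob (m : monad D) : globular (mu (mstr m)) /\ globular (eta (mstr m)).
  by split; [exact: mu_glob (mlaws m) | exact: eta_glob (mlaws m)].
elim: G p => [m|G IH m] p /=; first exact: mglob.
case: p => [q|]; first exact: tens_str_glob (IH q) (discr_str_glob _).
exact: tens_str_glob (disc_str_glob G) (mglob m).
Qed.

Lemma multimorphism_eq (G : inputs D) (m : monad D) (F F' : multimorphism N G m) :
  mm_map F = mm_map F' -> (forall p, mm_cell F p = mm_cell F' p) -> F = F'.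
Proof.
case: F F' => f phi H [f' phi' H'] /= ef ephi; subst f'.
have e := functional_extensionality_dep _ _ ephi; subst phi'.
by congr Multimorphism; exact: proof_irrelevance.
Qed.

End Tensor.

(** * The internal hom and the bijection *)

Theorem proposition3p3p8 (D : dbl_cat) (M : oplax_monoidal D)
    (N : normal M) (S : symmetric_dbl M) (K : closed_dbl M)
    (HI : fibrant D)
    (HII : forall A : C0 D, has_finite_coproducts (Mnd A))
    (HIII : has_equalisers (C0 D))
    (HIV : has_1_tabulators D)
    (b c : monad D) :
  exists (h : monad D) (E : multimorphism N (Some (Snoc (One h) b)) c),
    forall As : inputs D,
      bijective (comp1 E (G := As) :
        multimorphism N As h -> multimorphism N (append As b) c).
Proof.
have [H [e [eps2 [map2 U2]]]] := discrete_representable N K HIII HIV b c.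
(* Taking [e] for both boundaries puts [eps1] and [eps2] over the same vertical map, as a
   multimorphism requires. *)
have [h [eps1 [s1 t1 U1]]] := universal_cell_exists K HI (hid (mob b)) (mcar c) e e.
have e1 : sq_tgt eps1 = sq_src eps1 by rewrite s1.
have [T [LT Em En]] := universal_monad (mlaws c) U1 e1.
pose hm := @Monad D H (@MonadAt D H h T LT).
have map1 : is_mnd_map (tens_str N T (discr_str (mob b))
    (xi_iso_r N (mob b) h h)) (mstr c) e eps1.
  apply/tens_mnd_mapP; split=> // [e'|].
    by rewrite /= Em; congr (_ ∘ _ ∘ _); apply: hc_ext.
  by rewrite /= En s1.
have map2' : is_mnd_map (tens_str N (discr_str H) (mstr b)
    (xi_disc N (One hm) b)) (mstr c) e eps2.
  by move/tens_mnd_mapP: map2 => map2; apply/tens_mnd_mapP.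
pose cell (p : pos (Snoc (One hm) b)) : slot M p ⇒ mcar c :=
  match p return @slot D M (Snoc (One hm) b) p ⇒ mcar c with
  | Some _ => eps1 | None => eps2 end.
have Hcell p : is_mnd_map (slot_str N (G := Snoc (One hm) b) p) (mstr c) e (cell p).
  by case: p.
pose E := @Multimorphism D M N (Some (Snoc (One hm) b)) c e cell Hcell.
(* Uniqueness in [U2] concerns monad maps only, so the cell induced by [k'] is first shown to be
   one. *)
have U2inj Z (k k' : hom Z H) : eps2 ∘ (fmap (hidF D) k ⊠s[M] id1 (mcar b)) =
    eps2 ∘ (fmap (hidF D) k' ⊠s[M] id1 (mcar b)) -> k = k'.
  move=> ek.
  have mk := is_mnd_map_comp map2 (tens_map N (xi_iso_l N Z (mcar b) (mcar b))
    (xi_iso_l N H (mcar b) (mcar b)) (discr_map k') (is_mnd_map_id (mstr b))).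
  have [k0 [_ u]] := U2 _ _ _ _ mk.
  by rewrite -(u k ek) -(u k').
have src2 Z (k : hom Z H) :
    sq_src (eps2 ∘ (fmap (hidF D) k ⊠s[M] id1 (mcar b))) = e ∘ (k ⊠v[M] idm (mob b)).
  by rewrite fmapD src_stens (hid_src D) fmap1 (mm_src map2).
have iid := is_iso_idm (Hob (mcar b) : C1 D).
exists hm, E => As; apply: inj_surj_bijective; case: As => [G|].
- have it : is_iso (disc_norm M G ⊠s[M] id1 (mcar b)).
    exact: is_iso_tmor (disc_norm_iso N G) iid.
  move=> F F' EF.
  have cellE p : mm_cell (comp1 E F) p = mm_cell (comp1 E F') p by rewrite EF.
  (* The last cell determines the vertical map; the other cells then follow from universality of
     [eps1]. *)
  have eF : mm_map F = mm_map F'.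
    by apply: U2inj; apply: (iso_cancel it); exact: (cellE None).
  apply: (multimorphism_eq eF) => p.
  apply: (universal_cell_inj U1 (is_iso_idm (Hob (hid (mob b)) : C1 D))).
  + by rewrite (mm_src (mm_monad_map F p)) (mm_src (mm_monad_map F' p)).
  + by rewrite (mm_tgt (mm_monad_map F p)) (mm_tgt (mm_monad_map F' p)).
  exact: (cellE (Some p)).
- move=> F F' EF; apply: multimorphism_eq => [|[]].
  apply: U2inj.
  apply: (iso_cancel (is_iso_tmor (M1 M) (iota_iso N) iid)).
  apply: (iso_cancel (is_iso_inv (fwd_iso (tlunit (M1 M) (Hob (mcar b) : C1 D))))).
  have cellE p : mm_cell (comp1 E F) p = mm_cell (comp1 E F') p by rewrite EF.
  exact: (cellE tt).
- move=> F; have it : is_iso (disc_norm M G ⊠s[M] id1 (mcar b)).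
    exact: is_iso_tmor (disc_norm_iso N G) iid.
  have mN := tens_map N (xi_disc N G b) (xi_iso_l N _ _ _) (disc_norm_map N G)
    (is_mnd_map_id (mstr b)).
  rewrite tmor1 in mN.
  (* Undoing the normalisation of [disc M G] gives a monad map on [hid (tobj G) ⊠ b], to which [U2]
     applies. *)
  have mF := is_mnd_map_comp (mm_monad_map F None) (inv_mnd_map (is_iso_idm _) it mN).
  rewrite /= cmpm1 in mF.
  have [k [ek _]] := U2 _ _ _ _ mF.
  (* Comparing sources shows that [mm_map F] factors through [e], so [U1] applies to the remaining
     cells. *)
  have fk : mm_map F = e ∘ (k ⊠v[M] idm (mob b)) by rewrite -src2 ek (mm_src mF).
  have X p := U1 _ _ _ (mm_cell F (Some p) : slot M p ⊠h[M] hid (mob b) ⇒ mcar c) k k.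
  have {}X (p : pos G) : exists chi : slot M p ⇒ h,
      [/\ sq_src chi = k, sq_tgt chi = k &
         eps1 ∘ (chi ⊠s[M] id1 (hid (mob b))) = mm_cell F (Some p)].
    have [||chi [? _]] := X p; last by exists chi.
      by rewrite (mm_src (mm_monad_map F (Some p))) s1 fk.
    by rewrite (mm_tgt (mm_monad_map F (Some p))) t1 fk.
  pose phi p := proj1_sig (constructive_indefinite_description _ (X p)).
  have phiP p : [/\ sq_src (phi p) = k, sq_tgt (phi p) = k &
      eps1 ∘ (phi p ⊠s[M] id1 (hid (mob b))) = mm_cell F (Some p)].
    exact: proj2_sig (constructive_indefinite_description _ (X p)).
  have mphi p : is_mnd_map (slot_str N p) (mstr hm) k (phi p).
    have [sp tp ep] := phiP p; have [gm gn] := slot_str_glob N p.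
    apply: (universal_mnd_map U1 Em En (mu_glob LT) (eta_glob LT) gm gn sp tp).
    rewrite ep s1 -fk; exact: (mm_monad_map F (Some p)).
  exists (@Multimorphism D M N (Some G) hm k phi mphi).
  apply: multimorphism_eq => [|[p|]] //=.
  + by case: (phiP p).
  + rewrite ek /=.
    by rewrite -cmpA inv_comp cmpm1.
- move=> F.
  pose L := tlunit (M1 M) (Hob (mcar b) : C1 D).
  pose L0 := tlunit (M0 M) (mob b).
  have ij : is_iso ((iota M ⊠s[M] id1 (mcar b)) ∘ bwd L).
    apply: is_iso_cmp (is_iso_inv (fwd_iso L)).
    exact: is_iso_tmor (iota_iso N) iid.
  (* With no inputs [A_i], the only cell of [F] starts at [b]; the inverse of [lunit_map] transports
     it to [hid I ⊠ b]. *)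
  have mL := inv_mnd_map (is_iso_inv (fwd_iso L0)) ij (lunit_map N b).
  have mF := is_mnd_map_comp (mm_monad_map F tt) mL.
  have [k [ek _]] := U2 _ _ _ _ mF.
  have fk : mm_map F = e ∘ (k ⊠v[M] idm (mob b)) ∘ bwd L0.
    rewrite -src2 ek (mm_src mF) -cmpA.
    by rewrite inv_comp cmpm1.
  exists (@Multimorphism D M N None hm k (fun p => match p with end)
    (fun p => match p with end)).
  apply: multimorphism_eq => [|[]] //=.
  by rewrite -cmpA ek -cmpA inv_comp cmpm1.
Qed.
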